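(* For $G\in\mathsf{TMD}$, the canonical $G$-map $\iota\colon\mathrm{M}(G)\to\mathrm{UCF}(G)$ is highly proximal, equivalently irreducible.
   Context: All topological groups and flows are Hausdorff. For a topological group $G$, a $G$-flow is a compact space with a continuous left $G$-action $G\times X\to X$; it is minimal if every orbit is dense. A $G$-map is a continuous $G$-equivariant map. $\mathrm{M}(G)$ is the universal minimal flow: the (unique up to isomorphism) minimal $G$-flow admitting a $G$-map onto every minimal $G$-flow. For a symmetric open neighborhood $U$ of $e_G$ and a $G$-flow $X$, a nonempty open $A\subseteq X$ is $U$-TT if $A\subseteq\overline{UB}$ for every nonempty open $B\subseteq A$. A topological group $G$ is in $\mathsf{TMD}$ (has tractable minimal dynamics) if for every symmetric open neighborhood $U$ of $e_G$, every nonempty open $A\subseteq\mathrm{M}(G)$ contains a nonempty open $U$-TT set. A minimal flow $Y$ is proximal if for all $y_0,y_1\in Y$ there is a net $(g_i)$ in $G$ such that $g_iy_0$ and $g_iy_1$ converge to the same point. A $G$-map $\phi\colon Z\to Y$ of minimal flows is a compact group extension if there is a compact Hausdorff group $K$ acting continuously on $Z$ by $G$-flow automorphisms such that $\phi(x)=\phi(y)$ iff $k(x)=y$ for some $k\in K$. A compactification flow is a minimal flow which is a compact group extension of a proximal flow. $\mathrm{UCF}(G)$ is the universal compactification flow: the (unique up to isomorphism) compactification flow of $G$ that admits a $G$-map onto every compactification flow of $G$; it is the largest compact group extension of the universal minimal proximal flow of $G$. Any two $G$-maps $\mathrm{M}(G)\to\mathrm{UCF}(G)$ differ by an automorphism of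 $\mathrm{UCF}(G)$, so one speaks of the canonical one. A surjective $G$-map $\pi\colon Y\to X$ of flows is irreducible if every nonempty open $B\subseteq Y$ contains some fiber $\pi^{-1}[x]$, $x\in X$. It is highly proximal if for every $x\in X$ there is a net $(g_i)$ in $G$ with $g_i\cdot\pi^{-1}[x]$ converging to a singleton in the Vietoris topology on nonempty compact subsets of $Y$. (For minimal $Y$ the two notions coincide.) *)

(* Defs.v *)
From HB Require Import structures.
From mathcomp Require Import all_boot.
From mathcomp Require Import all_classical topology.

Set Implicit Arguments.
Unset Strict Implicit.
Unset Printing Implicit Defensive.

Local Open Scope classical_set_scope.

(* The Hausdorff axiom is not part of the structure: it is a separate
   hypothesis [hausdorff_space G] wherever a topological group occurs. *)
HB.mixin Record Group_isTopologicalGroup G & Topological G & Group G := {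
  mulg_continuous : continuous (fun p : G * G => (p.1 * p.2)%g) ;
  invg_continuous : continuous (fun g : G => (g^-1)%g) }.

#[short(type="topologicalGroupType")]
HB.structure Definition TopologicalGroup :=
  {G of Topological G & Group G & Group_isTopologicalGroup G}.

(* Nets: a map out of a directed set [D] converges iff its image of the filter
   [tails D] of eventual sets does, so that [u i @[i --> tails D] --> l] is
   convergence of the net [u] to [l]. *)
Record directed_set := DirectedSet {
  directed_sort :> Type ;
  directed_le : directed_sort -> directed_sort -> Prop ;
  directed_inhabited : exists i : directed_sort, True ;
  directed_refl : forall i, directed_le i i ;
  directed_trans : forall i j k,
    directed_le i j -> directed_le j k -> directed_le i k ;
  directed_upper : forall i j, exists k, directed_le i k /\ directed_le j k }.

Definition tails (D : directed_set) : set_system (directed_sort D) :=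
  filter_from [set: directed_sort D] (fun i => [set j | directed_le i j]).
Arguments tails D : clear implicits.

Global Instance tails_proper (D : directed_set) : ProperFilter (tails D).
Proof.
apply: filter_from_proper; last by move=> i _; exists i; exact: directed_refl.
apply: filter_from_filter.
  by have [i _] := directed_inhabited D; exists i.
move=> i j _ _; have [k [ik jk]] := directed_upper i j.
by exists k => // l kl; split; exact: directed_trans kl.
Qed.

(* The space of nonempty compact subsets of [Y], with the Vietoris topology:
   the subbasic open sets are {K | K `<=` O} and {K | K meets O}, O open. *)
Record hyperspace (Y : topologicalType) := Hyperspace {
  hset : set Y ;
  hset_compact : compact hset ;
  hset_nonempty : hset !=set0 }.

HB.instance Definition _ (Y : topologicalType) := gen_eqMixin (hyperspace Y).
HB.instance Definition _ (Y : topologicalType) :=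
  gen_choiceMixin (hyperspace Y).

Definition vietoris_subbase (Y : topologicalType) (i : bool * set Y) :
    set (hyperspace Y) :=
  if i.1 then [set K | hset K `<=` i.2] else [set K | hset K `&` i.2 !=set0].

HB.instance Definition _ (Y : topologicalType) :=
  @isSubBaseTopological.Build (hyperspace Y) (bool * set Y)%type
    [set i | open i.2] (@vietoris_subbase Y).

Definition hsingleton (Y : topologicalType) (y : Y) : hyperspace Y :=
  @Hyperspace Y [set y] (@compact_set1 Y y) (ex_intro _ y (erefl y)).

Definition is_continuous_action (G : topologicalGroupType)
    (X : topologicalType) (a : G -> X -> X) :=
  [/\ forall x, a 1%g x = x,
      forall g h x, a (g * h)%g x = a g (a h x)
    & continuous (fun p : G * X => a p.1 p.2)].

Record flow (G : topologicalGroupType) := Flow {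
  flow_sort :> topologicalType ;
  flow_compact : compact [set: flow_sort] ;
  flow_hausdorff : hausdorff_space flow_sort ;
  act : G -> flow_sort -> flow_sort ;
  act_continuous_action : is_continuous_action act }.

Section Flows.
Variable G : topologicalGroupType.
Implicit Types X Y Z M : flow G.

(* Flows are allowed to be empty, minimal ones are not. *)
Definition minimal X :=
  [set: X] !=set0 /\ forall x : X, dense (range (fun g : G => act g x)).

Definition G_map X Y (f : X -> Y) :=
  continuous f /\ forall g x, f (act g x) = act g (f x).

Definition surjective X Y (f : X -> Y) := set_surj [set: X] [set: Y] f.

Definition flow_automorphism X (f : X -> X) :=
  G_map f /\ exists h : X -> X, [/\ G_map h, cancel f h & cancel h f].

Definition universal_minimal_flow M :=
  minimal M /\
  forall X, minimal X -> exists f : M -> X, G_map f /\ surjective f.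

Definition symmetric_open_nbhd1 (U : set G) :=
  [/\ open U, U 1%g & forall g, U g -> U (g^-1)%g].

Definition is_TT (U : set G) X (A : set X) :=
  [/\ open A, A !=set0 &
      forall B : set X, open B -> B !=set0 -> B `<=` A ->
        A `<=` closure [set act u b | u in U & b in B]].

(* [universal_minimal_flow] determines M up to isomorphism. *)
Definition TMD :=
  forall M, universal_minimal_flow M ->
  forall U : set G, symmetric_open_nbhd1 U ->
  forall A : set M, open A -> A !=set0 ->
    exists2 C : set M, C `<=` A & is_TT U C.

Definition minimal_proximal Y :=
  minimal Y /\
  forall y0 y1 : Y, exists (D : directed_set) (g : D -> G) (z : Y),
    act (g i) y0 @[i --> tails D] --> z /\
    act (g i) y1 @[i --> tails D] --> z.

Definition compact_group_extension Z Y (phi : Z -> Y) :=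
  [/\ minimal Z, minimal Y, G_map phi &
      exists (K : topologicalGroupType) (k : K -> Z -> Z),
        [/\ compact [set: K] /\ hausdorff_space K,
            is_continuous_action k,
            forall c : K, flow_automorphism (k c) &
            forall x y : Z, phi x = phi y <-> exists c : K, k c x = y]].

Definition compactification_flow Z :=
  exists (Y : flow G) (phi : Z -> Y),
    minimal_proximal Y /\ compact_group_extension phi.

Definition universal_compactification_flow Z :=
  compactification_flow Z /\
  forall Y, compactification_flow Y ->
    exists f : Z -> Y, G_map f /\ surjective f.

Definition irreducible Y X (pi : Y -> X) :=
  [/\ G_map pi, surjective pi &
      forall B : set Y, open B -> B !=set0 ->
        exists x : X, pi @^-1` [set x] `<=` B].

Definition highly_proximal Y X (pi : Y -> X) :=
  [/\ G_map pi, surjective pi &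
      forall x : X,
        exists (D : directed_set) (g : D -> G) (K : D -> hyperspace Y) (y : Y),
          (forall i, hset (K i) = act (g i) @` (pi @^-1` [set x])) /\
          K i @[i --> tails D] --> hsingleton y].

End Flows.

(* Main.v *)
From HB Require Import structures.
Require Import Defs.
From mathcomp Require Import all_boot.
From mathcomp Require Import all_classical topology.

(* Write [K] for the group of automorphisms of [M]. The universal minimal flow is
   coalescent, so every nonempty closed invariant subset of [M * M] contains the
   graph of some element of [K]. Tractability is used only through the property
   [tame]: every nonempty open [A] contains a nonempty open [C] such that
   [n @` C `<=` A] for all [n] in [K] with [n @` C] meeting [C]. It implies that
   the sets [{b | b @` A meets a @` A}] are a base of neighbourhoods of [a] for a
   Hausdorff group topology on [K], which is compact by coalescence.
   To [p] in [M] associate the closed set [{(n, n p) | n in K}] of [K * M], a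
   point of a hyperspace. A minimal subflow of the closure of these points
   receives a map [psi] from [M]; normalised so that [(1, p)] lies in [psi p],
   it is unique, hence equivariant under the action of [K] on the hyperspace
   by translation of the first coordinate. So [psi @` M] is a [K]-extension
   of its orbit space, which is proximal because pairs [(p, n p)] are collapsed
   in it, and tameness makes [psi] irreducible. Finally
   [M -> Z -> psi @` M] agrees with [psi] up to an automorphism of [M], so
   [M -> Z] is irreducible as well. *)

Set Implicit Arguments.
Unset Strict Implicit.
Unset Printing Implicit Defensive.

Local Open Scope classical_set_scope.

(** * Topological preliminaries *)

Lemma open_prod_nbhs (X Y : topologicalType) (O : set (X * Y)) x y :
  open O -> O (x, y) ->
  exists (A : set X) (B : set Y),
  [/\ open A, open B, A x, B y & A `*` B `<=` O].
Proof.
move=> oO Oxy; have : nbhs (x, y) O by apply: open_nbhs_nbhs.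
case=> -[/= A B] [nA nB] AB.
move: nA nB; rewrite !nbhsE /= => -[A' [oA' A'x] A'A] [B' [oB' B'y] B'B].
exists A', B'; split=> // -[a b] [/= /A'A Aa /B'B Bb]; exact: AB.
Qed.

Lemma tube_lemma (X Y : topologicalType) (C : set X) (y : Y) (W : set (X * Y)) :
  compact C -> open W -> (forall x, C x -> W (x, y)) ->
  \forall y' \near y, forall x, C x -> W (x, y').
Proof.
move=> /compact_near_coveringP cC oW CW.
have := cC Y (nbhs y) (fun y' x => W (x, y')) _; apply=> x Cx.
have [A [B [oA oB Ax By AB]]] := open_prod_nbhs oW (CW _ Cx).
by exists (A, B) => [|[x' y'] [Ax' By']]; [split; exact: open_nbhs_nbhs|exact: AB].
Qed.

Lemma open_setX (X Y : topologicalType) (A : set X) (B : set Y) :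
  open A -> open B -> open (A `*` B).
Proof.
rewrite !openE => oA oB -[a b] [/= /oA nA /oB nB].
by exists (A, B).
Qed.

Lemma hausdorff_sep (X : topologicalType) (x y : X) :
  hausdorff_space X -> x <> y ->
  exists (A B : set X), [/\ open A, open B, A x, B y & forall z, A z -> ~ B z].
Proof.
rewrite open_hausdorff => hX /eqP /hX [[A B] /= [xA yB] [oA oB /eqP AB]].
exists A, B; split=> //; [exact: set_mem|exact: set_mem|].
by move=> z Az Bz; have : (A `&` B) z by []; rewrite AB.
Qed.

Lemma compact_hausdorff_regular (X : topologicalType) (O : set X) x :
  compact [set: X] -> hausdorff_space X -> open O -> O x ->
  exists A, [/\ open A, A x & closure A `<=` O].
Proof.
move=> cX hX oO Ox.
have [A nA AO] := @compact_regular X x setT hX cX filterT O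
  (open_nbhs_nbhs (conj oO Ox)).
exists A°; split=> //; first exact: open_interior.
exact: subset_trans (closureS (@interior_subset _ _)) AO.
Qed.

Lemma hausdorff_prod (X Y : topologicalType) :
  hausdorff_space X -> hausdorff_space Y -> hausdorff_space (X * Y)%type.
Proof.
move=> hX hY; rewrite open_hausdorff => -[x y] [x' y'] /eqP ne.
have [exx'|/(hausdorff_sep hX)[A [B [oA oB Ax Bx AB]]]] := pselect (x = x').
  have /(hausdorff_sep hY)[A [B [oA oB Ax Bx AB]]] : y <> y'.
    by move=> e; apply: ne; rewrite exx' e.
  exists ([set: X] `*` A, [set: X] `*` B); first by rewrite !inE.
  split; [exact: open_setX openT oA|exact: open_setX openT oB|].
  by apply/eqP; rewrite -subset0 => -[a b] [[_ /= Ab] [_ /= Bb]]; exact: AB Ab Bb.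
exists (A `*` [set: Y], B `*` [set: Y]); first by rewrite !inE.
split; [exact: open_setX oA openT|exact: open_setX oB openT|].
by apply/eqP; rewrite -subset0 => -[a b] [[/= Ab _] [/= Bb _]]; exact: AB Ab Bb.
Qed.

Lemma compact_setT_closed (X : topologicalType) (A : set X) :
  compact [set: X] -> closed A -> compact A.
Proof. by move=> cX cA; exact: subclosed_compact cA cX _. Qed.

Lemma closureP (X : topologicalType) (A : set X) x :
  closure A x <-> forall O, open O -> O x -> A `&` O !=set0.
Proof.
split=> [cA O oO Ox|cA B]; first exact: cA (open_nbhs_nbhs (conj oO Ox)).
rewrite nbhsE => -[O [oO Ox] OB].
by have [y [Ay /OB By]] := cA O oO Ox; exists y.
Qed.

Lemma continuous_pair (T X Y : topologicalType) (f : T -> X) (g : T -> Y) :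
  continuous f -> continuous g -> continuous (fun t => (f t, g t)).
Proof. by move=> cf cg t; apply: cvg_pair; [exact: cf|exact: cg]. Qed.

Lemma continuous_compose (X Y Z : topologicalType) (f : X -> Y) (g : Y -> Z) :
  continuous f -> continuous g -> continuous (fun x => g (f x)).
Proof. by move=> cf cg x; apply: continuous_comp; [exact: cf|exact: cg]. Qed.

(** * The Vietoris topology *)

Section Hyperspace.
Variable Y : topologicalType.

(** Finite intersections of subbasic sets form a base, so convergence can be tested on the two kinds
    of subbasic neighbourhoods separately. *)
Lemma hyp_cvg (F : set_system (hyperspace Y)) (K : hyperspace Y) :
  Filter F ->
  (forall O, open O -> hset K `<=` O -> F [set L | hset L `<=` O]) ->
  (forall O, open O -> hset K `&` O !=set0 -> F [set L | hset L `&` O !=set0]) ->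
  F --> K.
Proof.
move=> FF Fsub Fmeet N; rewrite nbhsE /= => -[B [[D' D'D <-]] [A D'A AK]].
move=> /filterS; apply; have [D sD eA] := D'D _ D'A.
apply: (@filterS _ F _ A); first by move=> x Ax; exists A.
rewrite -eA; apply: filter_bigI => -[[] O] iD /=.
  have := sD _ iD; rewrite inE => oO; apply: Fsub => //=.
  by move: AK; rewrite -eA => /(_ _ iD).
have := sD _ iD; rewrite inE => oO; apply: Fmeet => //=.
by move: AK; rewrite -eA => /(_ _ iD).
Qed.

Lemma open_hyp_sub (O : set Y) :
  open O -> open [set K : hyperspace Y | hset K `<=` O].
Proof.
move=> oO; exists [set [set K | hset K `<=` O]]; last by rewrite bigcup_set1.
by move=> _ ->; exact: (@finI_from1 _ _ [set i | open i.2] _ (true, O)).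
Qed.

Lemma open_hyp_meet (O : set Y) :
  open O -> open [set K : hyperspace Y | hset K `&` O !=set0].
Proof.
move=> oO; exists [set [set K | hset K `&` O !=set0]];
  last by rewrite bigcup_set1.
by move=> _ ->; exact: (@finI_from1 _ _ [set i | open i.2] _ (false, O)).
Qed.

Lemma hyp_ext (K L : hyperspace Y) : hset K = hset L -> K = L.
Proof.
case: K L => [K cK nK] [L cL nL] /= e.
by subst L; congr Hyperspace; exact: Prop_irrelevance.
Qed.

Hypotheses (cY : compact [set: Y]) (hY : hausdorff_space Y).

(** An ultrafilter [F] converges to the set [L] of points all of whose neighbourhoods meet
    [F]-almost every member. A point off [L] has a neighbourhood missed by almost every member, and
    compactness makes one [F]-large set serve a whole closed set disjoint from [L]. *)
Lemma hyp_compact : compact [set: hyperspace Y].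
Proof.
rewrite compact_ultra => F FU _.
pose L := [set y : Y | forall O, open O -> O y ->
  F [set K | hset K `&` O !=set0]].
have far y : ~ L y -> exists2 O, open O /\ O y &
    F [set K | ~ (hset K `&` O !=set0)].
  move=> /existsNP[O] /not_implyP[oO] /not_implyP[Oy nF]; exists O => //.
  by have [//|] := in_ultra_setVsetC [set K | hset K `&` O !=set0] FU.
have away C : closed C -> (forall y, C y -> ~ L y) ->
    F [set K | hset K `<=` ~` C].
  move=> /(compact_setT_closed cY)/compact_near_coveringP cC CL.
  apply: filterS (cC _ F (fun K y => ~ hset K y) _ _).
    by move=> K /= CK y Ky Cy; exact: CK Cy Ky.
  move=> y /CL /far [O [oO Oy] FO].
  exists (O, [set K | ~ (hset K `&` O !=set0)]).
    by split=> //=; exact: open_nbhs_nbhs.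
  by move=> [y' K] [/= Oy' nK] Ky'; apply: nK; exists y'.
have clL : closed L.
  move=> y /closureP cy O oO Oy.
  by have [z [Lz Oz]] := cy O oO Oy; exact: Lz.
have L0 : L !=set0.
  apply: contrapT => nL; have : F set0; last exact: filter_not_empty.
  have := away setT closedT.
  have -> : [set K : hyperspace Y | hset K `<=` ~` setT] = set0.
    rewrite -subset0 => K /= KT; have [y Ky] := hset_nonempty K.
    exact: KT Ky Logic.I.
  by apply=> y _ Ly; apply: nL; exists y.
exists (Hyperspace (compact_setT_closed cY clL) L0); split=> //.
apply: hyp_cvg => O oO /=.
  move=> LO; have := away (~` O) (open_closedC oO); rewrite setCK; apply.
  by move=> y nO /LO.
by move=> [y [Ly Oy]]; exact: Ly.
Qed.

(** Regularity gives [V] whose closure misses [K]. This is closedness of the membership relation, in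
    the form of separating neighbourhoods. *)
Lemma hyp_notin_open (K : hyperspace Y) y : ~ hset K y ->
  exists (P : set (hyperspace Y)) (V : set Y),
  [/\ open P, open V, P K, V y & forall L z, P L -> V z -> ~ hset L z].
Proof.
move=> nKy.
have [||V [oV Vy cV]] :=
  @compact_hausdorff_regular Y (~` hset K) y cY hY.
- apply: closed_openC; exact: compact_closed hY (@hset_compact _ K).
- exact: nKy.
exists [set L | hset L `<=` ~` closure V], V; split=> //.
- by apply: open_hyp_sub; exact/closed_openC/closed_closure.
- by move=> z Kz /cV; apply.
- by move=> L z LV Vz /LV; apply; exact: subset_closure.
Qed.

Lemma hyp_hausdorff : hausdorff_space (hyperspace Y).
Proof.
rewrite open_hausdorff => K L /eqP neKL.
wlog [y [Ky nLy]] : K L neKL / exists y, hset K y /\ ~ hset L y.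
  move=> wl; have [KL|/existsNP[y /not_implyP Hy]] :=
    pselect (hset K `<=` hset L); last first.
    by apply: wl => //; exists y.
  have [LK|/existsNP[y /not_implyP Hy]] := pselect (hset L `<=` hset K).
    by case: neKL; apply: hyp_ext; rewrite eqEsubset.
  have [|[A B] [/= a b] [/= oA oB AB]] := wl L K (nesym neKL); first by exists y.
  by exists (B, A) => //; split=> //; rewrite setIC.
have [P [V [oP oV PL Vy PV]]] := hyp_notin_open nLy.
exists ([set M | hset M `&` V !=set0], P).
  by rewrite !inE; split=> //; exists y.
split=> //; first exact: open_hyp_meet.
by apply/eqP; rewrite -subset0 => M [[z [Mz Vz]] /PV/(_ Vz)].
Qed.

End Hyperspace.

(** * Continuous actions and constructions of flows *)

Definition himage (X Y : topologicalType) (f : X -> Y) (cf : continuous f)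
    (K : hyperspace X) : hyperspace Y :=
  Hyperspace (continuous_compact (continuous_subspaceT cf) (@hset_compact _ K))
    (image_nonempty f (hset_nonempty K)).

Section Actions.
Variables (G : topologicalGroupType) (X : topologicalType) (a : G -> X -> X).
Hypothesis ca : is_continuous_action a.

Lemma action1 x : a 1%g x = x. Proof. by case: ca. Qed.
Lemma actionM g h x : a (g * h)%g x = a g (a h x). Proof. by case: ca. Qed.
Lemma action_continuous2 : continuous (fun p : G * X => a p.1 p.2).
Proof. by case: ca. Qed.

Lemma action_cvg T (F : set_system T) (u : T -> G) (v : T -> X) g x :
  Filter F -> u @ F --> g -> v @ F --> x -> a (u t) (v t) @[t --> F] --> a g x.
Proof.
move=> FF cu cv.
apply: (cvg_comp (fun t => (u t, v t)) (fun p : G * X => a p.1 p.2)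
  (cvg_pair cu cv)).
exact: (action_continuous2 (x := (g, x))).
Qed.

Lemma actionK g : cancel (a g) (a g^-1%g).
Proof. by move=> x; rewrite -actionM mulVg action1. Qed.
Lemma actionVK g : cancel (a g^-1%g) (a g).
Proof. by move=> x; rewrite -actionM mulgV action1. Qed.

Lemma action_nbhs g x (O : set X) : open O -> O (a g x) ->
  exists (N : set G) (A : set X), [/\ open N, open A, N g, A x &
    forall h y, N h -> A y -> O (a h y)].
Proof.
move=> oO Ogx; have oW := (continuousP (fun p : G * X => a p.1 p.2)).1
  action_continuous2 O oO.
have [N [A [oN oA Ng Ax NA]]] := @open_prod_nbhs _ _ _ g x oW Ogx.
by exists N, A; split=> // h y Nh Ay; exact: (NA (h, y)).
Qed.

Lemma action_continuous g : continuous (a g).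
Proof.
apply/continuousP => O oO; rewrite openE => x /= Ogx.
have [N [A [_ oA Ng Ax NA]]] := action_nbhs oO Ogx.
by rewrite /interior nbhsE /=; exists A => // y Ay; exact: NA.
Qed.

Lemma open_action_preimage g (A : set X) : open A -> open [set x | A (a g x)].
Proof. by move=> oA; exact: (continuousP (a g)).1 (@action_continuous g) _ oA. Qed.

Lemma image_actionE g (A : set X) : a g @` A = [set x | A (a g^-1%g x)].
Proof.
apply/seteqP; split=> [_ [x Ax <-]|x Ax] /=; first by rewrite actionK.
by exists (a g^-1%g x) => //; rewrite actionVK.
Qed.

Lemma open_action_image g (A : set X) : open A -> open (a g @` A).
Proof. by rewrite image_actionE; exact: open_action_preimage. Qed.

Lemma image_closure_action g (A : set X) :
  a g @` closure A = closure (a g @` A).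
Proof.
apply/seteqP; split=> [_ [x /closureP cx <-]|].
  apply/closureP => O oO Ogx.
  have [y [Ay Oy]] := cx _ (open_action_preimage g oO) Ogx.
  by exists (a g y); split=> //; exists y.
rewrite [X in _ `<=` X]image_actionE => x /closureP cx.
apply/closureP => O oO Ogx.
have [|_ [[y Ay <-] [z Oz /(can_inj (actionK g)) zy]]] :=
  cx _ (open_action_image g oO).
  by exists (a g^-1%g x) => //; rewrite actionVK.
by exists y; split=> //; rewrite -zy.
Qed.

Definition hyp_action g : hyperspace X -> hyperspace X :=
  himage (@action_continuous g).

Hypotheses (cX : compact [set: X]) (hX : hausdorff_space X).

Lemma hyp_action_continuous_action : is_continuous_action hyp_action.
Proof.
split.
- move=> K; apply: hyp_ext; rewrite /= (_ : a 1%g = id) ?image_id //.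
  by apply/funext=> x; exact: action1.
- move=> g h K; apply: hyp_ext; rewrite /= image_comp; congr (_ @` _).
  by apply/funext=> x; exact: actionM.
- move=> [g K] /=; apply: hyp_cvg => O oO /=.
    move=> KO; have /compact_near_coveringP cT := cX.
    (* The covering runs over all of [X], since sets close to [K] may contain points off [K]: near a
       point of [K] the action stays in [O], and near any other point membership in a nearby set
       fails. *)
    apply: filterS (cT _ (nbhs (g, K))
      (fun p y => hset p.2 y -> O (a p.1 y)) _ _).
      by move=> [h L] /= H _ [y Ly <-]; exact: H.
    move=> y _; have [Ky|nKy] := pselect (hset K y).
      have [N [A [oN oA Ng Ay NA]]] := action_nbhs oO (KO _ (imageP _ Ky)).
      exists (A, [set p : G * hyperspace X | N p.1]) => /=.
        split; first exact: open_nbhs_nbhs.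
        exists (N, setT); last by move=> ? [].
        by split; [exact: open_nbhs_nbhs|exact: filterT].
      by move=> [y' [h L]] [/= Ay' Nh] _; exact: NA.
    have [P [V [oP oV PK Vy PV]]] := hyp_notin_open cX hX nKy.
    exists (V, [set p : G * hyperspace X | P p.2]) => /=.
      split; first exact: open_nbhs_nbhs.
      exists (setT, P); last by move=> ? [].
      by split; [exact: filterT|exact: open_nbhs_nbhs].
    by move=> [y' [h L]] [/= Vy' PL] Ly'; case: (PV _ _ PL Vy').
- move=> [_ [[y Ky <-] Ogy]].
  have [N [A [oN oA Ng Ay NA]]] := action_nbhs oO Ogy.
  exists (N, [set L | hset L `&` A !=set0]).
    split; first exact: open_nbhs_nbhs.
    by apply: open_nbhs_nbhs; split; [exact: open_hyp_meet|exists y].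
  by move=> [h L] [/= Nh [z [Lz Az]]]; exists (a h z); split; [exists z|exact: NA].
Qed.

End Actions.

Section SetType.
Variables (X : topologicalType) (S : set X).

Lemma set_val_continuous : continuous (fun x : S => \val x).
Proof. exact: initial_continuous. Qed.

Lemma continuous_into_set_type (T : topologicalType) (f : T -> S) :
  continuous (fun t => \val (f t)) -> continuous f.
Proof. exact: (@continuous_comp_initial S T X). Qed.

Lemma set_valP (x : S) : S (\val x).
Proof. exact: set_mem (valP x). Qed.

Lemma hausdorff_set_type : hausdorff_space X -> hausdorff_space S.
Proof.
move=> hX; rewrite open_hausdorff => x y /eqP ne.
have [|A [B [oA oB Ax By AB]]] := @hausdorff_sep X (\val x) (\val y) hX.
  by move=> /val_inj.
exists ([set z : S | A (\val z)], [set z : S | B (\val z)]).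
  by rewrite !inE.
split; [exact: (continuousP _).1 set_val_continuous _ oA|
        exact: (continuousP _).1 set_val_continuous _ oB|].
by apply/eqP; rewrite -subset0 => z [/= Az Bz]; exact: AB Az Bz.
Qed.

Lemma compact_set_type : compact S -> compact [set: S].
Proof.
move=> cS F PF _; pose F' := fmap (fun x : S => \val x) F.
have [|x [Sx cx]] := cS F' _.
  by rewrite /F' /fmap /=; apply: filterS (filterT) => x _; exact: set_valP.
exists (exist _ x (mem_set Sx)); split=> // A B FA [_ [[U oU <-] Ux UB]].
have [_ [[y Ay <-] Uy]] := cx ((fun x : S => \val x) @` A) U
   (filterS (fun y Ay => imageP _ Ay) FA) (open_nbhs_nbhs (conj oU Ux)).
by exists y; split=> //; exact: UB.
Qed.

End SetType.

Section SubAction.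
Variables (G : topologicalGroupType) (X : topologicalType) (a : G -> X -> X).
Hypothesis ca : is_continuous_action a.
Variable S : set X.
Hypothesis aS : forall g x, S x -> S (a g x).

Definition sub_action (g : G) (x : S) : S :=
  exist _ (a g (\val x)) (mem_set (aS g (set_valP x))).

Lemma sub_action_continuous_action : is_continuous_action sub_action.
Proof.
split.
- by move=> x; apply: val_inj; exact: action1 ca _.
- by move=> g h x; apply: val_inj; exact: actionM ca _ _ _.
- apply: continuous_into_set_type => -[g x] /=.
  apply: (action_cvg ca); first exact: cvg_fst.
  by apply: cvg_comp; [exact: cvg_snd|exact: set_val_continuous].
Qed.

End SubAction.

Section FlowConstructions.
Variable G : topologicalGroupType.
Implicit Types X Y : flow G.

Definition invariant X (S : set X) := forall g x, S x -> S (act g x).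

Lemma actP X : is_continuous_action (@act G X).
Proof. exact: act_continuous_action. Qed.

Section Subflow.
Variables (X : flow G) (S : set X) (cS : closed S) (iS : invariant S).

Definition subflow : flow G :=
  @Flow G S (compact_set_type (compact_setT_closed (@flow_compact _ X) cS))
    (hausdorff_set_type (@flow_hausdorff _ X)) (sub_action iS)
    (sub_action_continuous_action (actP X) iS).

End Subflow.

Section Product.
Variables X Y : flow G.

Definition prod_act (g : G) (p : X * Y) := (act g p.1, act g p.2).

Lemma prod_act_continuous_action : is_continuous_action prod_act.
Proof.
split.
- by move=> [x y]; rewrite /prod_act !(action1 (actP _)).
- by move=> g h [x y]; rewrite /prod_act !(actionM (actP _)).
- move=> [g [x y]]; apply: cvg_pair => /=.
  + apply: (action_cvg (actP X)); first exact: cvg_fst.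
    by apply: cvg_comp; [exact: cvg_snd|exact: cvg_fst].
  + apply: (action_cvg (actP Y)); first exact: cvg_fst.
    by apply: cvg_comp; [exact: cvg_snd|exact: cvg_snd].
Qed.

Lemma prod_compact : compact [set: X * Y].
Proof. by rewrite -setXTT; apply: compact_setX; exact: flow_compact. Qed.

Definition prod_flow : flow G :=
  Flow prod_compact
   (hausdorff_prod (@flow_hausdorff _ X) (@flow_hausdorff _ Y))
   prod_act_continuous_action.

End Product.

Definition hyp_flow X : flow G :=
  Flow (hyp_compact (@flow_compact _ X) )
    (hyp_hausdorff (@flow_compact _ X) (@flow_hausdorff _ X))
    (hyp_action_continuous_action (actP X) (@flow_compact _ X)
      (@flow_hausdorff _ X)).

Section Trivial.
Variables (T : topologicalType) (cT : compact [set: T]) (hT : hausdorff_space T).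

Lemma trivial_continuous_action : is_continuous_action (fun (_ : G) (t : T) => t).
Proof. by split=> // -[g t]; exact: cvg_snd. Qed.

Definition trivial_flow : flow G := Flow cT hT trivial_continuous_action.

End Trivial.
End FlowConstructions.

(** * Minimal sets *)

Lemma chain_bigcap_nonempty (X : topologicalType) (F : set (set X)) :
  compact [set: X] -> F !=set0 -> total_on F subset ->
  (forall A, F A -> closed A /\ A !=set0) -> \bigcap_(A in F) A !=set0.
Proof.
move=> cX F0 Ftot FA.
have PF : ProperFilter (filter_from F id).
  apply: filter_from_proper; last by move=> A /FA[].
  apply: filter_from_filter => // A B fA fB.
  have [AB|BA] := Ftot _ _ fA fB.
    by exists A => // x Ax; split=> //; exact: AB.
  by exists B => // x Bx; split=> //; exact: BA.
have [|x [_ cx]] := cX _ PF; first by case: F0 => A FA'; exists A.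
exists x => A fA; have [cA _] := FA _ fA; apply: cA => B nB.
by apply: cx => //; exists A.
Qed.

Lemma exists_minimal_closed (X : topologicalType) (P : set (set X)) (Q : set X) :
  compact [set: X] ->
  (forall F : set (set X), F !=set0 -> F `<=` P -> P (\bigcap_(A in F) A)) ->
  P Q -> closed Q -> Q !=set0 ->
  exists S, [/\ S `<=` Q, closed S, S !=set0, P S &
    forall T, closed T -> T !=set0 -> P T -> T `<=` S -> S `<=` T].
Proof.
move=> cX Pcap PQ cQ Q0.
pose C := [set A : set X |
  [/\ ~` A `<=` Q, closed (~` A), (~` A) !=set0 & P (~` A)]].
have [F FC Ftot|A [[[AQ cA A0 PA]|PA] maxA]] := @Zorn_bigcup X (C `|` [set set0]).
  have [F0|/forallNP F0] := pselect (exists A, F A /\ C A); last first.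
    right; rewrite /= -subset0 => x [A FA Ax].
    by case: (FC _ FA) => [CA|A0]; [case: (F0 A)|rewrite -A0].
  pose F' := [set ~` A | A in F `&` C].
  have F'E : ~` (\bigcup_(A in F) A) = \bigcap_(B in F') B.
    apply/seteqP; split=> [x nx _ [A [FA _] <-] Ax|x nx [A FA Ax]].
      by apply: nx; exists A.
    case: (FC _ FA) => [CA|A0]; last by rewrite A0 in Ax.
    by have := nx (~` A); apply=> //; exists A.
  case: F0 => A0 [FA0 CA0]; left; split; rewrite ?F'E.
  - by move=> x H; case: (CA0) => AQ _ _ _; apply: AQ; apply: H; exists A0.
  - by apply: closed_bigI => _ [A [_ [_ ? _ _]] <-].
  - apply: chain_bigcap_nonempty => //; first by exists (~` A0), A0.
      move=> _ _ [A [FA _] <-] [B [FB _] <-].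
      by have [AB|BA] := Ftot _ _ FA FB; [right|left]; apply: subsetC.
    by move=> _ [A [_ [_ ? ? _]] <-].
  - apply: Pcap; first by exists (~` A0), A0.
    by move=> _ [A [_ [_ _ _ ?]] <-].
- exists (~` A); split=> // T cT T0 PT TA x nAx; apply: contrapT => nTx.
  apply: (maxA (~` T)); last first.
    by left; rewrite /C /= setCK; split=> //; apply: subset_trans AQ.
  split; first by rewrite -[A]setCK; apply: subsetC.
  by move=> /(_ _ nTx).
- exists Q; split=> // T cT T0 PT TQ x Qx; apply: contrapT => nTx.
  apply: (maxA (~` T)); last by left; rewrite /C /= setCK; split.
  by rewrite PA; split=> // /(_ x nTx).
Qed.

Section Minimality.
Variable G : topologicalGroupType.
Implicit Types X Y Z M : flow G.

Definition minimal_set X (S : set X) :=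
  [/\ closed S, S !=set0, invariant S &
    forall T : set X, closed T -> T !=set0 -> invariant T -> T `<=` S -> S `<=` T].

Lemma exists_minimal_set X (Q : set X) :
  closed Q -> Q !=set0 -> invariant Q -> exists2 S, S `<=` Q & minimal_set S.
Proof.
move=> cQ Q0 iQ.
have [|S [SQ cS S0 iS mS]] := @exists_minimal_closed X (@invariant G X) Q
  (@flow_compact _ X) _ iQ cQ Q0.
  by move=> F _ FI g x H A FA; apply: FI => //; exact: H.
by exists S => //; split.
Qed.

Lemma closure_invariant X (S : set X) : invariant S -> invariant (closure S).
Proof.
move=> iS g x /closureP cx; apply/closureP => O oO Ogx.
have [y [Sy Oy]] := cx _ (open_action_preimage (actP X) g oO) Ogx.
by exists (act g y); split=> //; exact: iS.
Qed.

Lemma orbit_invariant X (x : X) : invariant (range (fun g : G => act g x)).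
Proof.
move=> g _ [h _ <-]; exists (g * h)%g => //.
exact: actionM (actP X) _ _ _.
Qed.

Lemma minimal_closed_invariant X (S : set X) :
  minimal X -> closed S -> S !=set0 -> invariant S -> forall x, S x.
Proof.
move=> [_ dX] cS [y Sy] iS x; apply: contrapT => nSx.
have [||z [nS [g _ gy]]] := dX y (~` S); first by exists x.
  exact: closed_openC.
by apply: nS; rewrite -gy; exact: iS.
Qed.

Lemma minimal_flowP X : [set: X] !=set0 ->
  (forall S : set X, closed S -> S !=set0 -> invariant S -> forall x, S x) ->
  minimal X.
Proof.
move=> X0 H; split=> // x O [y Oy] oO.
have /closureP/(_ O oO Oy)[z [? ?]] : closure (range (fun g : G => act g x)) y.
  apply: H; first exact: closed_closure.
    by exists x; apply: subset_closure; exists 1%g => //; exact: action1 (actP X) _.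
  exact/closure_invariant/orbit_invariant.
by exists z.
Qed.

Lemma minimal_translate X (O : set X) (x : X) :
  minimal X -> open O -> O !=set0 -> exists g : G, O (act g x).
Proof.
move=> [_ /(_ x O)d] oO O0; have [z [Oz [g _ gx]]] := d O0 oO.
by exists g; rewrite gx.
Qed.

Lemma minimal_subflow X (S : set X) (cS : closed S) (iS : invariant S) :
  minimal_set S -> minimal (subflow cS iS).
Proof.
move=> [_ [x Sx] _ mS]; apply: minimal_flowP.
  by exists (exist _ x (mem_set Sx)).
move=> T cT T0 iT [y Sy] /=.
have [||||z Tz e] := mS ((fun x : S => \val x) @` T) _ _ _ _ y (set_mem Sy).
- apply: compact_closed; first exact: flow_hausdorff.
  apply: continuous_compact; first exact/continuous_subspaceT/set_val_continuous.
  exact: (compact_setT_closed (@flow_compact _ (subflow cS iS))).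
- by case: T0 => z Tz; exists (\val z), z.
- by move=> g _ [z Tz <-]; exists (act (f := subflow cS iS) g z) => //; exact: iT.
- by move=> _ [z Tz <-]; exact: set_valP.
by rewrite (_ : exist _ y Sy = z) //; apply: val_inj; rewrite e.
Qed.

Lemma G_map_surj X Y (f : X -> Y) : [set: X] !=set0 -> minimal Y -> G_map f ->
  forall y, exists x, f x = y.
Proof.
move=> [x0 _] mY [cf ef] y.
have [|||x _ fx] := @minimal_closed_invariant Y (range f) mY _ _ _ y.
- apply: compact_closed; first exact: flow_hausdorff.
  apply: continuous_compact; first exact: continuous_subspaceT.
  exact: flow_compact.
- by exists (f x0), x0.
- by move=> g _ [x _ <-]; exists (act g x).
- by exists x.
Qed.

Lemma minimal_image X Y (f : X -> Y) : minimal X -> G_map f ->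
  (forall y, exists x, f x = y) -> minimal Y.
Proof.
move=> mX [cf ef] sf; apply: minimal_flowP.
  by case: mX => -[x _] _; exists (f x).
move=> S cS [y Sy] iS z; have [x <-] := sf z.
apply: (@minimal_closed_invariant X (f @^-1` S)) => //.
- exact: (continuous_closedP f).1.
- by have [w fw] := sf y; exists w; rewrite /= fw.
- by move=> g w /=; rewrite ef; exact: iS.
Qed.

Lemma G_map_comp X Y Z (f : X -> Y) (g : Y -> Z) : G_map f -> G_map g ->
  G_map (g \o f).
Proof.
move=> [cf ef] [cg eg]; split=> [x|h x]; last by rewrite /= ef eg.
by apply: continuous_comp; [exact: cf|exact: cg].
Qed.

(** A continuous map from a compact space to a Hausdorff one is closed, so the set-theoretic inverse
    is continuous. *)
Lemma bijective_G_map_automorphism X (f : X -> X) : G_map f -> injective f ->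
  (forall y, exists x, f x = y) -> flow_automorphism f.
Proof.
move=> Gf fI /choice[h fh]; have hf : cancel f h by move=> x; apply: fI; rewrite fh.
split=> //; exists h; split=> //; split; last first.
  by move=> g x; apply: fI; rewrite fh Gf.2 fh.
apply/continuous_closedP => C cC; have -> : h @^-1` C = f @` C.
  apply/seteqP; split=> [x Chx|_ [x Cx <-]] /=; last by rewrite hf.
  by exists (h x).
apply: compact_closed; first exact: flow_hausdorff.
apply: continuous_compact; first exact/continuous_subspaceT/Gf.1.
exact: (compact_setT_closed (@flow_compact _ X)).
Qed.

End Minimality.

(** * The Ellis semigroup and coalescence *)

Section Ellis.
Import ArrowAsProduct.
Variables (G : topologicalGroupType) (X : flow G).

Lemma cvg_prod_topology (I : eqType) (K : I -> topologicalType)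
    (F : set_system (prod_topology K)) (f : prod_topology K) : Filter F ->
  (forall i, proj i @ F --> f i) -> F --> f.
Proof.
move=> FF H; apply/cvg_sup => i U [_ [[B oB <-] Bf BU]].
by apply: filterS BU _; apply: (H i); exact: open_nbhs_nbhs.
Qed.

(** All self-maps of [X], continuous or not, with pointwise convergence. *)
Let P : topologicalType := prod_topology (fun _ : X => X : topologicalType).

Let power_act (g : G) (p : P) : P := fun x => act g (p x).

Lemma power_act_continuous_action : is_continuous_action power_act.
Proof.
split.
- by move=> p; apply/funext => x; exact: action1 (actP X) _.
- by move=> g h p; apply/funext => x; exact: actionM (actP X) _ _ _.
- move=> [g p]; apply: cvg_prod_topology => x /=.
  have cx : (q.2 : P) x @[q --> nbhs (g, p)] --> p x.
    exact: (@cvg_comp _ _ _ (fun q : G * P => q.2) (fun q : P => q x) _ (nbhs p)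
      _ cvg_snd (@proj_continuous X (fun=> X) x p)).
  exact: (@action_cvg _ _ _ (actP X) _ (nbhs (g, p)) (fun q : G * P => q.1)
    (fun q : G * P => q.2 x) g (p x) _ cvg_fst cx).
Qed.

Lemma power_compact : compact [set: P].
Proof.
suff -> : [set: P] = [set f : X -> X | forall i, [set: X] (f i)].
  exact: (@tychonoff X (fun=> X) (fun=> setT) (fun=> @flow_compact _ X)).
by apply/seteqP; split.
Qed.

Definition power_flow : flow G :=
  @Flow G P power_compact
   (@hausdorff_product X (fun=> X) (fun=> @flow_hausdorff _ X))
   power_act power_act_continuous_action.

Lemma proj_power_continuous (x : X) :
  continuous (fun p : power_flow => (p : X -> X) x).
Proof. exact: (@proj_continuous X (fun=> X)). Qed.

(** Precomposition only selects coordinates of the product, so it is continuous even when [q] is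
    not. *)
Lemma comp_power_continuous (q : X -> X) :
  continuous (fun p : power_flow => ((p : X -> X) \o q : power_flow)).
Proof.
move=> p; apply: cvg_prod_topology => [|x].
  exact: (@fmap_filter _ _ _ _ (nbhs_filter p)).
exact: (@proj_power_continuous (q x) p).
Qed.

End Ellis.

Arguments comp_power_continuous {G X} q _ _ _ : rename.

Section EllisIdeal.
Variables (G : topologicalGroupType) (X : flow G).
Local Notation P := (power_flow X).
Local Notation "p \c q" := ((p : X -> X) \o (q : X -> X) : P) (at level 50).

(** The Ellis semigroup of [X]; the minimal closed invariant subset [I] below is a minimal left
    ideal of it. *)
Let E : set P := closure (range (fun g : G => act g : P)).

Variable I : set P.
Hypotheses (IE : I `<=` E) (cI : closed I) (iI : invariant I).
Hypothesis mI : minimal_set I.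

(** Precomposition with [q] is continuous and sends the translations into the closed set [I], hence
    also their closure [E]. *)
Let comp_mem p q : E p -> I q -> I (p \c q).
Proof.
move=> Ep Iq.
have : closed [set p : P | I (p \c q)].
  exact: (continuous_closedP (fun p : P => p \c q)).1 (comp_power_continuous q) _ cI.
apply; apply: closureS Ep => _ [g _ <-]; exact: iI.
Qed.

(** The set [I q] is closed, nonempty, invariant and contained in [I], so minimality makes it all of
    [I]. *)
Let ideal_right_translate q r : I q -> I r -> exists2 p, I p & p \c q = r.
Proof.
move=> Iq Ir; case: mI => _ I0 _ /(_ [set p \c q | p in I]); apply => //.
- apply: compact_closed; first exact: flow_hausdorff.
  apply: continuous_compact; first exact/continuous_subspaceT/comp_power_continuous.
  exact: compact_setT_closed (@flow_compact _ P) cI.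
- by case: I0 => p Ip; exists (p \c q), p.
- by move=> g _ [p Ip <-]; exists (act g p) => //; exact: iI.
- by move=> _ [p Ip <-]; exact: comp_mem (IE Ip) Iq.
Qed.

(** Ellis's idempotent lemma. In a minimal closed subsemigroup [S] of [I] containing [p], first
    [S p = S]; then the elements [q] of [S] with [q p = p] form a nonempty closed subsemigroup,
    which is therefore [S] and contains [p]. *)
Let exists_idempotent : exists2 v, I v & v \c v = v.
Proof.
have [] := @exists_minimal_closed P
  (fun S => forall p q : P, S p -> S q -> S (p \c q)) I (@flow_compact _ P).
- by move=> F _ FP p q Fp Fq A FA; apply: FP => //; [exact: Fp|exact: Fq].
- by move=> p q Ip Iq; exact: comp_mem (IE Ip) Iq.
- exact: cI.
- by case: mI.
move=> S [SI cS [p Sp] sS mS]; exists p; first exact: SI.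
have Sp_S : S `<=` [set q \c p | q in S].
  apply: mS.
  - apply: compact_closed; first exact: flow_hausdorff.
    apply: continuous_compact; first exact/continuous_subspaceT/comp_power_continuous.
    exact: compact_setT_closed (@flow_compact _ P) cS.
  - by exists (p \c p), p.
  - move=> _ _ [q Sq <-] [r Sr <-]; exists (q \c p \c r) => //.
    by apply: (sS) => //; exact: sS.
  - by move=> _ [q Sq <-]; exact: sS.
have [_ //] : (S `&` [set q : P | q \c p = p]) p.
apply: mS => //.
- apply: closedI => //.
  have cl1 : closed [set p : P].
    exact: compact_closed (@flow_hausdorff _ P) (@compact_set1 _ _).
  exact: (continuous_closedP (fun q : P => q \c p)).1 (comp_power_continuous p) _ cl1.
- by have [q Sq qp] := Sp_S _ Sp; exists q.
- move=> q r [Sq qp] [Sr rp]; split; first exact: sS.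
  by rewrite /= -compA [_ \o (p : X -> X)]rp.
Qed.

(** With [v] an idempotent of [I], the endomorphism [h] is right composition with [k = h v]; this
    [k] has a right inverse [v s] relative to the unit [v], and cancelling it gives injectivity. *)
Lemma ideal_endomorphism_injective (h : subflow cI iI -> subflow cI iI) :
  G_map h -> injective h.
Proof.
move=> [ch eh]; pose S := subflow cI iI.
(* The graph of [h] is closed, which upgrades equivariance under [G] to equivariance under the whole
   of [E]. *)
pose A : set (P * P)%type := (fun z : S => (\val z, \val (h z))) @` [set: S].
have cA : closed A.
  apply: compact_closed.
    exact: hausdorff_prod (@flow_hausdorff _ P) (@flow_hausdorff _ P).
  apply: continuous_compact; last exact: (@flow_compact _ S).
  apply/continuous_subspaceT/continuous_pair; first exact: set_val_continuous.
  by apply: continuous_compose; [exact: ch|exact: set_val_continuous].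
have hA p (q : S) : E p -> A (p \c \val q, p \c \val (h q)).
  move=> Ep; have : closed [set p : P | A (p \c \val q, p \c \val (h q))].
    apply: (continuous_closedP (fun p : P => (p \c \val q, p \c \val (h q)))).1 => //.
    by apply: continuous_pair; exact: comp_power_continuous.
  apply; apply: closureS Ep => _ [g _ <-].
  exists (act g q) => //; by rewrite eh.
have hM p (q r : S) : I p -> \val r = p \c \val q ->
    \val (h r) = p \c \val (h q).
  move=> Ip rE; have [z _ [zE <-]] := hA p q (IE Ip).
  by congr (\val (h _)); apply: val_inj; rewrite rE.
have [v Iv vv] := exists_idempotent.
have fixv p : I p -> p \c v = p.
  move=> Ip; have [q Iq <-] := ideal_right_translate Iv Ip.
  by rewrite /= -compA [_ \o (v : X -> X)]vv.
pose V : S := exist _ v (mem_set Iv); pose k : P := \val (h V).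
have Ik : I k by exact: set_valP.
have hE (q : S) : \val (h q) = \val q \c k.
  by apply: hM; [exact: set_valP|rewrite fixv //; exact: set_valP].
have vk : v \c k = k by exact: esym (hE V).
have [s Is sk] := ideal_right_translate Ik Iv.
have [t It ts] := ideal_right_translate (comp_mem (IE Iv) Is) Iv.
(* Here [v s] is a left inverse of [k] and [t] a left inverse of [v s]; as in a monoid with unit
   [v], this forces [k = t]. *)
have ks : k \c (v \c s) = v.
  have vsk : (v \c s) \c k = v by rewrite /= -compA [_ \o (k : X -> X)]sk vv.
  suff -> : k = t by [].
  by rewrite -vk -{1}ts /= -compA [_ \o (k : X -> X)]vsk; exact: fixv.
move=> p q hpq; apply: val_inj.
have pI := set_valP p; have qI := set_valP q.
have e : \val p \c k = \val q \c k by have := congr1 val hpq; rewrite !hE.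
have fixE (r : P) : I r -> r = (r \c k) \c (v \c s).
  by move=> Ir; exact: etrans (esym (fixv r Ir))
    (congr1 (fun w : P => r \c w) (esym ks)).
exact: etrans (fixE _ pI)
  (etrans (congr1 (fun w : P => w \c (v \c s)) e) (esym (fixE _ qI))).
Qed.

End EllisIdeal.

Section Coalescence.
Variables (G : topologicalGroupType) (M : flow G).
Implicit Types X Y : flow G.
Hypothesis uM : universal_minimal_flow M.

(** For a minimal left ideal [S] of the Ellis semigroup, evaluation at [x0] maps [S] onto [M], and
    universality maps [M] to [S]. The composite endomorphism of [S] through [f] is injective, and
    this passes to [f] because evaluation is onto. *)
Lemma coalescent (f : M -> M) : G_map f -> flow_automorphism f.
Proof.
move=> Gf; have [mM univ] := uM; have [[x0 _] _] := mM.
have sf := G_map_surj mM.1 mM Gf.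
apply: bijective_G_map_automorphism => //.
pose E : set (power_flow M) := closure (range (fun g : G => act g : power_flow M)).
have [||| I IE mI] := @exists_minimal_set G (power_flow M) E.
- exact: closed_closure.
- by exists (act 1%g); apply: subset_closure; exists 1%g.
- apply: closure_invariant => g _ [h _ <-]; exists (g * h)%g => //.
  by apply/funext => x; exact: actionM (actP M) _ _ _.
have [cI _ iI _] := mI; pose S := subflow cI iI.
have mS : minimal S := minimal_subflow cI iI mI.
have [phi [Gphi _]] := univ S mS.
pose ev (s : S) : M := (\val s : M -> M) x0.
have Gev : G_map ev.
  split=> //; exact: (@continuous_compose I (power_flow M) M _ _
    (@set_val_continuous _ I) (@proj_power_continuous _ M x0)).
have sev := G_map_surj mS.1 mM Gev.
have inj : injective (phi \o (f \o ev)).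
  apply: (@ideal_endomorphism_injective _ _ _ IE cI iI mI).
  exact: G_map_comp (G_map_comp Gev Gf) Gphi.
move=> x y fxy; have [s sx] := sev x; have [t ty] := sev y.
by rewrite -sx -ty; congr ev; apply: inj; rewrite /= sx ty fxy.
Qed.

Lemma fst_G_map X Y : G_map (fun p : @prod_flow G X Y => p.1).
Proof. by split=> // p; exact: cvg_fst. Qed.

Lemma snd_G_map X Y : G_map (fun p : @prod_flow G X Y => p.2).
Proof. by split=> // p; exact: cvg_snd. Qed.

Lemma subflow_val_G_map X (S : set X) (cS : closed S) (iS : @invariant G X S) :
  G_map (fun x : subflow cS iS => \val x).
Proof. by split=> //; exact: set_val_continuous. Qed.

(* By coalescence both projections of a minimal subset of [M * M] to [M] are
   bijective, so that such a subset is a graph. *)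
Lemma contains_graph (Q : set (prod_flow M M)) :
  closed Q -> Q !=set0 -> invariant Q ->
  exists2 f : M -> M, flow_automorphism f & forall x, Q (x, f x).
Proof.
move=> cQ Q0 iQ; have [S SQ mS] := exists_minimal_set cQ Q0 iQ.
have [cS _ iS _] := mS.
have [phi [Gphi _]] := uM.2 _ (minimal_subflow cS iS mS).
have Gv := G_map_comp Gphi (subflow_val_G_map cS iS).
have aut1 := coalescent (G_map_comp Gv (@fst_G_map M M)).
have G2 := G_map_comp Gv (@snd_G_map M M).
have [_ [h [Gh _ hK]]] := aut1.
exists (fun x => (\val (phi (h x))).2).
  exact: (coalescent (G_map_comp Gh G2)).
move=> x; rewrite -{1}[x]hK /= -surjective_pairing.
by apply: SQ; exact: set_valP.
Qed.

End Coalescence.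

(** * Tameness, and its derivation from tractability *)

Definition tame (G : topologicalGroupType) (M : flow G) :=
  forall A : set M, open A -> A !=set0 ->
  exists C : set M, [/\ open C, C !=set0, C `<=` A &
    forall f, flow_automorphism f -> (exists2 x, C x & C (f x)) ->
      forall x, C x -> A (f x)].

Section Automorphisms.
Variables (G : topologicalGroupType) (X : flow G).
Implicit Types f g : X -> X.

Lemma aut_comp f g :
  flow_automorphism f -> flow_automorphism g -> flow_automorphism (f \o g).
Proof.
move=> [Gf [f' [Gf' fK f'K]]] [Gg [g' [Gg' gK g'K]]].
split; first exact: G_map_comp Gg Gf.
exists (g' \o f'); split; first exact: G_map_comp Gf' Gg'.
  exact: can_comp.
exact: can_comp.
Qed.

Lemma aut_id : flow_automorphism (@id X).
Proof. by split; [|exists id; split]; split => // x; exact: cvg_id. Qed.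

Lemma aut_inv f : flow_automorphism f ->
  exists h, [/\ flow_automorphism h, cancel f h & cancel h f].
Proof. by move=> [Gf [h [Gh fK hK]]]; exists h; split=> //; split=> //; exists f. Qed.

Lemma aut_open_image f (A : set X) :
  flow_automorphism f -> open A -> open (f @` A).
Proof.
move=> [_ [h [[ch _] fK hK]]] oA; have -> : f @` A = h @^-1` A.
  by apply/seteqP; split=> [_ [x Ax <-]|x Ax]; rewrite /= ?fK //; exists (h x).
exact: (continuousP h).1.
Qed.

Lemma aut_open_preimage f (A : set X) :
  flow_automorphism f -> open A -> open (f @^-1` A).
Proof. by move=> [[cf _] _]; exact: (continuousP f).1. Qed.

End Automorphisms.

(** Choose a [U]-TT set [C] inside [B], where [U] moves [B] into [A1]. If [f] sends a point of [C]
    into [C], the points of [C] sent into [C] form a nonempty open set [D], so [C] lies in the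
    closure of [U D]. Since [f] commutes with [G], the image of [C] lies in the closure of [U C],
    hence in [closure A1], hence in [A]. *)
Lemma TMD_tame (G : topologicalGroupType) (M : flow G) :
  TMD G -> universal_minimal_flow M -> tame M.
Proof.
move=> tG uM A oA [x Ax].
have [A1 [oA1 A1x cA1]] := compact_hausdorff_regular (@flow_compact _ M)
  (@flow_hausdorff _ M) oA Ax.
have A11 : A1 (act 1%g x) by rewrite (action1 (actP M)).
have [N [B [oN oB N1 Bx NB]]] := action_nbhs (actP M) oA1 A11.
pose U := N `&` [set g : G | N (g^-1)%g].
have sU : symmetric_open_nbhd1 U.
  split.
  - apply: openI => //; apply: (continuousP (fun g : G => (g^-1)%g)).1 => //.
    exact: invg_continuous.
  - by split=> //=; rewrite invg1.
  - by move=> g [? ?]; split=> //=; rewrite invgK.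
have B0 : B !=set0 by exists x.
have [C CB [oC C0 TC]] := tG M uM U sU B oB B0.
exists C; split=> //.
  move=> y /CB By; apply/cA1/subset_closure; rewrite -(action1 (actP M) y).
  exact: NB.
move=> f af [y Cy Cfy] z Cz; apply/cA1/closureP => O oO Ofz.
have oD : open (C `&` f @^-1` C) by apply: openI => //; exact: aut_open_preimage.
have /closureP /(_ (f @^-1` O) (aut_open_preimage af oO) Ofz) :=
  TC _ oD (ex_intro _ y (conj Cy Cfy)) (@subIsetl _ _ _) z Cz.
move=> [_ [[g [Ng _] [w [_ Cfw] <-]] Ow]]; exists (f (act g w)); split=> //.
by rewrite af.1.2; apply: NB => //; exact: CB.
Qed.

(** * The automorphism group of a tame flow *)

(** Minimality and tameness are parameters of the type so that the instances declared on it can use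
    them: minimality makes the neighbourhoods a filter, tameness makes the product continuous. *)
Record aut_group (G : topologicalGroupType) (M : flow G) (mM : minimal M)
    (tM : tame M) := AutGroup {
  aut_fun :> M -> M ;
  aut_funP : flow_automorphism aut_fun }.

Section AutGroup.
Variables (G : topologicalGroupType) (M : flow G) (mM : minimal M).
Variable tM : tame M.
Local Notation K := (aut_group mM tM).
Implicit Types a b c : K.

Lemma aut_ext a b : (forall x, a x = b x) -> a = b.
Proof.
case: a b => [a aP] [b bP] /= ab; have e : a = b by apply/funext.
by subst b; congr AutGroup; exact: Prop_irrelevance.
Qed.

Lemma aut_act a g x : a (act g x) = act g (a x).
Proof. by case: (aut_funP a) => -[]. Qed.

Lemma aut_continuous a : continuous a.
Proof. by case: (aut_funP a) => -[]. Qed.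

HB.instance Definition _ := gen_eqMixin K.
HB.instance Definition _ := gen_choiceMixin K.

Definition aut_one : K := AutGroup mM tM (aut_id M).
Definition aut_mul a b : K := AutGroup mM tM (aut_comp (aut_funP a) (aut_funP b)).
Definition aut_inverse a : K :=
  let h := cid (aut_inv (aut_funP a)) in
  AutGroup mM tM (let: And3 H _ _ := svalP h in H).

Lemma aut_inverseK a : cancel a (aut_inverse a).
Proof. by rewrite /aut_inverse /=; case: cid => h [? ? ?]. Qed.

Lemma aut_inverseVK a : cancel (aut_inverse a) a.
Proof. by rewrite /aut_inverse /=; case: cid => h [? ? ?]. Qed.

Lemma aut_mulA : associative aut_mul.
Proof. by move=> a b c; exact: aut_ext. Qed.
Lemma aut_mul1 : left_id aut_one aut_mul.
Proof. by move=> a; exact: aut_ext. Qed.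
Lemma aut_1mul : right_id aut_one aut_mul.
Proof. by move=> a; exact: aut_ext. Qed.
Lemma aut_mulV : left_inverse aut_one aut_inverse aut_mul.
Proof. by move=> a; apply: aut_ext => x /=; exact: aut_inverseK. Qed.
Lemma aut_Vmul : right_inverse aut_one aut_inverse aut_mul.
Proof. by move=> a; apply: aut_ext => x /=; exact: aut_inverseVK. Qed.

HB.instance Definition _ := isGroup.Build K aut_mulA aut_mul1 aut_1mul
  aut_mulV aut_Vmul.

Lemma autM a b x : (a * b)%g x = a (b x). Proof. by []. Qed.
Lemma autK a x : (a^-1)%g (a x) = x. Proof. exact: aut_inverseK. Qed.
Lemma autVK a x : a ((a^-1)%g x) = x. Proof. exact: aut_inverseVK. Qed.

Definition aut_ball (A : set M) a : set K :=
  [set b | exists x y, [/\ A x, A y & b x = a y]].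

Definition aut_nbhs a : set_system K :=
  filter_from [set A : set M | open A /\ A !=set0] (aut_ball^~ a).

HB.instance Definition _ := hasNbhs.Build K aut_nbhs.

(** Automorphisms commute with translations, so both witnesses of a ball can be moved by one [g],
    chosen so that [A] meets the preimage of [B]. *)
Lemma aut_ballI (A B : set M) : open A -> A !=set0 -> open B -> B !=set0 ->
  exists C, [/\ open C, C !=set0 &
    forall a, aut_ball C a `<=` aut_ball A a `&` aut_ball B a].
Proof.
move=> oA [x Ax] oB B0; have [g Bg] := minimal_translate x mM oB B0.
exists (A `&` [set x | B (act g x)]); split.
- by apply: openI => //; exact: open_action_preimage (actP M) _ _ oB.
- by exists x.
- move=> a b [y [z [[Ay By] [Az Bz] e]]]; split; first by exists y, z.
  by exists (act g y), (act g z); split=> //; rewrite !aut_act e.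
Qed.

(** Keeping only the points of [A] that [b] sends into the image of [A] under [a] lets an equation
    [c z = b w] be rewritten as [c z = a v] with [v] in [A]. *)
Lemma aut_ball_open a b (A : set M) : open A -> aut_ball A a b ->
  exists D, [/\ open D, D !=set0 & aut_ball D b `<=` aut_ball A a].
Proof.
move=> oA [x [y [Ax Ay e]]].
exists (A `&` b @^-1` (a @` A)); split.
- apply: openI => //; apply: aut_open_preimage; first exact: aut_funP.
  exact: aut_open_image (aut_funP a) oA.
- by exists x; split=> //=; exists y.
- move=> c [z [w [[Az _] [Aw [v Av av]] cz]]].
  by exists z, v; split=> //; rewrite cz.
Qed.

Lemma aut_nbhs_filter a : ProperFilter (nbhs a).
Proof.
apply: filter_from_proper; last first.
  by move=> A [oA [x Ax]]; exists a, x, x.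
apply: filter_from_filter.
  by exists setT; split; [exact: openT|exact: mM.1].
move=> A B [oA A0] [oB B0]; have [C [oC C0 CAB]] := aut_ballI oA A0 oB B0.
by exists C => //; exact: CAB.
Qed.

Lemma aut_nbhs_singleton a (S : set K) : nbhs a S -> S a.
Proof. by move=> [A [oA [x Ax]]]; apply; exists x, x. Qed.

Lemma aut_nbhs_nbhs a (S : set K) : nbhs a S -> nbhs a (nbhs^~ S).
Proof.
move=> [A [oA A0] AS]; exists A => // b /(aut_ball_open oA)[D [oD D0 DA]].
by exists D => //; exact: subset_trans DA AS.
Qed.

HB.instance Definition _ := Nbhs_isNbhsTopological.Build K aut_nbhs_filter
  aut_nbhs_singleton aut_nbhs_nbhs.

Lemma aut_ball_nbhs (A : set M) a : open A -> A !=set0 -> nbhs a (aut_ball A a).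
Proof. by move=> oA A0; exists A. Qed.

Lemma open_aut_ball (A : set M) a : open A -> open (aut_ball A a).
Proof.
move=> oA; rewrite openE => b /(aut_ball_open oA)[D [oD D0 DA]].
by exists D.
Qed.

Lemma tame_aut (A : set M) : open A -> A !=set0 -> exists C : set M,
  [/\ open C, C !=set0, C `<=` A &
    forall a x, aut_ball C 1%g a -> C x -> A (a x)].
Proof.
move=> oA A0; have [C [oC C0 CA H]] := tM oA A0.
exists C; split=> // a x [y [z [Cy Cz e]]]; apply: H; first exact: aut_funP.
by exists y => //; rewrite e.
Qed.

(** If [c] is in the balls of [C] around [a] and [b], then [a^-1 c] and [b^-1 c] lie in the ball
    around 1. By tameness both send [C] to points that [a] moves into [U] and [b] into [V], so [c y]
    lies in [U] and in [V]. *)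
Lemma aut_hausdorff : hausdorff_space K.
Proof.
rewrite open_hausdorff => a b /eqP neab.
have [x neabx] : exists x, a x <> b x.
  apply: contrapT => /forallNP H; apply: neab.
  by apply: aut_ext => x; apply: contrapT.
have [U [V [oU oV Ux Vx UV]]] := hausdorff_sep (@flow_hausdorff _ M) neabx.
have [||C [oC C0 CA tC]] := @tame_aut (a @^-1` U `&` b @^-1` V).
- by apply: openI; apply: aut_open_preimage => //; exact: aut_funP.
- by exists x.
exists (aut_ball C a, aut_ball C b).
  by case: C0 => y Cy; rewrite !inE; split; exists y, y.
split; [exact: open_aut_ball|exact: open_aut_ball|].
apply/eqP; rewrite -subset0 => c [/= [y [z [Cy Cz cy]]] [y' [z' [Cy' Cz' cy']]]].
have [Ua _] : (a @^-1` U `&` b @^-1` V) ((a^-1 * c)%g y).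
  by apply: (tC) => //; exists y, z; split=> //; rewrite autM cy autK.
have [_ Vb] : (a @^-1` U `&` b @^-1` V) ((b^-1 * c)%g y).
  by apply: (tC) => //; exists y', z'; split=> //; rewrite autM cy' autK.
apply: (UV (c y)); first by rewrite -(autVK a (c y)); exact: Ua.
by rewrite -(autVK b (c y)); exact: Vb.
Qed.

Lemma aut_inv_continuous : continuous (fun a : K => (a^-1)%g).
Proof.
move=> a S [A [oA A0] AS]; exists ((a^-1)%g @` A).
  split; first exact: aut_open_image (aut_funP _) oA.
  by case: A0 => x Ax; exists ((a^-1)%g x), x.
move=> b [_ [_ [[x Ax <-] [y Ay <-] e]]]; apply: AS.
exists y, x; split=> //; apply: (can_inj (autK b)).
by rewrite autVK e autVK.
Qed.

(** Tameness is used twice, for [D] within [C] within [A]: the element [b^-1 b'] maps [D] into [C],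
    and [b^-1 a^-1 a' b] maps [C] into [A]. Their product is [(a b)^-1 a' b']. *)
Lemma aut_mul_continuous : continuous (fun p : K * K => (p.1 * p.2)%g).
Proof.
move=> [a b] S [A [oA A0] AS].
have [C [oC C0 CA tC]] := tame_aut oA A0.
have [D [oD D0 DC tD]] := tame_aut oC C0.
have obD : open (b @` D) by exact: aut_open_image (aut_funP _) oD.
have bD0 : (b @` D) !=set0 by case: D0 => x Dx; exists (b x), x.
(* The image of [D] under [b] is used around [a] so that conjugating by [b] leads back to [D]. *)
exists (aut_ball (b @` D) a, aut_ball D b).
  by split; exact: aut_ball_nbhs.
move=> [a' b'] /= [].
move=> [_ [_ [[x Dx <-] [y Dy <-] e]]] [x' [y' [Dx' Dy' e']]]; apply: AS.
have Cm : C ((b^-1 * b')%g x').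
  by apply: (tD) => //; exists x', y'; split=> //; rewrite autM e' autK.
exists x', ((b^-1 * a^-1 * a' * b)%g ((b^-1 * b')%g x')); split.
- by apply: CA; exact: DC.
- apply: (tC) => //; exists x, y; split; [exact: DC|exact: DC|].
  by rewrite !autM e !autK.
- by rewrite !autM !autVK.
Qed.

HB.instance Definition _ := Group_isTopologicalGroup.Build K aut_mul_continuous
  aut_inv_continuous.

(** Let [q] be a cluster point of the points [a p] along [F]. The orbit closure of [(p, q)] contains
    the graph of an automorphism, which is a cluster point of [F]. *)
Lemma aut_compact : universal_minimal_flow M -> compact [set: K].
Proof.
move=> uM F PF _; have [[p _] _] := mM.
have [q [_ cq]] := @flow_compact _ M (fmap (fun a : K => a p) F) _ filterT.
pose orb : set (prod_flow M M) :=
  range (fun g : G => act g ((p, q) : prod_flow M M)).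
have [||| f af Qf] := contains_graph uM (Q := closure orb).
- exact: closed_closure.
- by exists (act 1%g ((p, q) : prod_flow M M)); apply: subset_closure; exists 1%g.
- exact/closure_invariant/orbit_invariant.
exists (AutGroup mM tM af); split=> // S T FS [A [oA [x Ax]] AT].
have oAA : open (A `*` (f @` A)) by apply: open_setX => //; exact: aut_open_image.
have [|_ [[g _ <-] [/= Ap [y Ay fy]]]] := (closureP _ _).1 (Qf x) _ oAA.
  by split=> //; exists x.
(* Since [g q] lies in the image of [A] under [f], so does [g (a p) = a (g p)] for some [a] in [S];
   as [g p] is in [A], this puts [a] in the ball of [A] around [f]. *)
have [_ [[a Sa <-] /= Aq]] := cq ((fun a : K => a p) @` S)
  [set z | (f @` A) (act g z)]
  (filterS (fun y Ay => imageP _ Ay) FS)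
  (open_nbhs_nbhs (conj (open_action_preimage (actP M) g (aut_open_image af oA))
    (ex_intro2 _ _ y Ay fy))).
exists a; split=> //; apply: AT; case: Aq => z Az fz.
by exists (act g p), z; split=> //; rewrite aut_act -fz.
Qed.

End AutGroup.

(** * Orbit spaces and nets *)

Lemma continuous_range_closed (X Y : topologicalType) (f : X -> Y) :
  compact [set: X] -> hausdorff_space Y -> continuous f -> closed (range f).
Proof.
move=> cX hY cf; apply: compact_closed => //; apply: continuous_compact => //.
exact: continuous_subspaceT.
Qed.

Section ImageFlow.
Variables (G : topologicalGroupType) (X Y : flow G) (f : X -> Y).
Hypothesis Gf : G_map f.

Lemma range_invariant : invariant (range f).
Proof. by move=> g _ [x _ <-]; exists (act g x) => //; rewrite Gf.2. Qed.

Definition range_flow : flow G := subflow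
  (continuous_range_closed (@flow_compact _ X) (@flow_hausdorff _ Y) Gf.1)
  range_invariant.

Definition to_range (x : X) : range_flow :=
  exist _ (f x) (mem_set (ex_intro2 _ _ x Logic.I erefl)).

Lemma to_range_G_map : G_map to_range.
Proof.
split; first by apply: continuous_into_set_type; exact: Gf.1.
by move=> g x; apply: val_inj; exact: Gf.2.
Qed.

Lemma to_range_surj y : exists x, to_range x = y.
Proof. by have [x _ xy] := set_valP y; exists x; apply: val_inj. Qed.

End ImageFlow.

Section OrbitSpace.
Variables (G K : topologicalGroupType) (X : flow G) (k : K -> X -> X).
Hypotheses (ck : is_continuous_action k) (cK : compact [set: K]).
Hypothesis kG : forall c g x, k c (act g x) = act g (k c x).

Lemma orbit_compact x : compact (range (fun c => k c x)).
Proof.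
apply: continuous_compact => //; apply: continuous_subspaceT => c.
by apply: (action_cvg ck) => //; exact: cvg_cst.
Qed.

(** The orbit space is realised as a set of points of the hyperspace; as a closed subspace it is
    then compact and Hausdorff. *)
Definition orbit_hyp (x : X) : hyp_flow X :=
  Hyperspace (@orbit_compact x) (ex_intro _ _ (ex_intro2 _ _ 1%g Logic.I erefl)).

(** Orbits near one contained in [O] stay in [O] by compactness of [K] and the tube lemma; those
    near one meeting [O] meet it by continuity of a single [k c]. *)
Lemma orbit_hyp_continuous : continuous orbit_hyp.
Proof.
move=> x; apply: hyp_cvg => O oO /=.
  move=> kO; have oW : open [set p : K * X | O (k p.1 p.2)].
    exact: (continuousP (fun p : K * X => k p.1 p.2)).1 (action_continuous2 ck) _ oO.
  have := tube_lemma cK oW (y := x)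
    (fun c _ => kO _ (ex_intro2 _ _ c Logic.I erefl)).
  by apply: filterS => y Hy _ [c _ <-]; exact: Hy.
move=> [_ [[c _ <-] Ocx]].
apply: filterS (open_nbhs_nbhs (conj (open_action_preimage ck c oO) Ocx)) => y Ocy.
by exists (k c y); split=> //; exists c.
Qed.

Lemma orbit_hyp_G_map : G_map orbit_hyp.
Proof.
split; first exact: orbit_hyp_continuous.
move=> g x; apply: hyp_ext; apply/seteqP; split=> [_ [c _ <-]|_ [_ [c _ <-] <-]].
  by exists (k c x); [exists c|rewrite kG].
by exists c => //; rewrite kG.
Qed.

Lemma orbit_hyp_eq x y : orbit_hyp x = orbit_hyp y <-> exists c, k c x = y.
Proof.
split=> [xy|[c <-]].
  have : hset (orbit_hyp x) y by rewrite xy; exists 1%g => //; exact: action1 ck _.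
  by move=> [c _ cx]; exists c.
apply: hyp_ext; apply/seteqP; split=> _ [d _ <-].
  by exists (d * c^-1)%g => //; rewrite (actionM ck) (actionK ck).
by exists (d * c)%g => //; rewrite (actionM ck).
Qed.

Definition orbit_flow := range_flow orbit_hyp_G_map.
Definition orbit_map : X -> orbit_flow := to_range orbit_hyp_G_map.

Lemma orbit_map_eq x y : orbit_map x = orbit_map y <-> exists c, k c x = y.
Proof.
rewrite -orbit_hyp_eq; split=> [/(congr1 val)//|xy].
exact: val_inj.
Qed.

End OrbitSpace.

Section NbhsDirected.
Variables (Y : topologicalType) (y : Y).

Lemma nbhs_inhabited : exists B : {B : set Y | nbhs y B}, True.
Proof. by exists (exist _ setT filterT). Qed.

Lemma nbhs_upper (A B : {B : set Y | nbhs y B}) : exists C : {B : set Y | nbhs y B},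
  sval C `<=` sval A /\ sval C `<=` sval B.
Proof.
by exists (exist _ _ (filterI (svalP A) (svalP B))); split=> z [].
Qed.

Definition nbhs_directed : directed_set :=
  @DirectedSet {B : set Y | nbhs y B} (fun A B => sval B `<=` sval A)
    nbhs_inhabited (fun A => @subset_refl _ _)
    (fun A B C AB BC => subset_trans BC AB) nbhs_upper.

Lemma nbhs_directed_cvg (T : topologicalType) (u : nbhs_directed -> T) (l : T) :
  (forall N, nbhs l N -> exists A : nbhs_directed,
     forall B : nbhs_directed, sval B `<=` sval A -> N (u B)) ->
  u i @[i --> tails nbhs_directed] --> l.
Proof.
move=> H N /H [A HA]; exists A => // B; exact: HA.
Qed.

End NbhsDirected.

Lemma closure_prod_cvg (G : topologicalGroupType) (Y : flow G) (y0 y1 z : Y) :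
  closure (range (fun g : G => (act g y0, act g y1))) (z, z) ->
  exists (D : directed_set) (g : D -> G),
    act (g i) y0 @[i --> tails D] --> z /\ act (g i) y1 @[i --> tails D] --> z.
Proof.
move=> cz.
have /choice[g gP] : forall B : nbhs_directed z, exists g : G,
    sval B (act g y0) /\ sval B (act g y1).
  move=> [B nB]; have [|_ [[g _ <-] [/= ? ?]]] := cz (B `*` B); last by exists g.
  by exists (B, B).
by exists (nbhs_directed z), g; split; apply: nbhs_directed_cvg => N nN;
  exists (exist _ N nN) => B /= BN; apply: BN; case: (gP B).
Qed.

(** Every neighbourhood of a fixed point [x0] contains a translate of the fibre; these translates,
    indexed by the neighbourhoods, converge to [x0]. *)
Lemma irreducible_highly_proximal (G : topologicalGroupType) (X Y : flow G)
    (pi : X -> Y) : minimal X -> minimal Y -> irreducible pi -> highly_proximal pi.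
Proof.
move=> mX mY [Gpi spi irr]; split=> // y.
have [[x0 _] _] := mX.
have fibre (B : set X) : nbhs x0 B ->
    exists g : G, act g @` (pi @^-1` [set y]) `<=` B.
  rewrite nbhsE => -[O [oO Ox0] OB]; have [z zO] := irr O oO (ex_intro _ x0 Ox0).
  (* The points whose whole fibre lies in [O]. This set is open because [pi] is a closed map, and
     minimality of [Y] moves [y] into it. *)
  pose V := ~` (pi @` (~` O)).
  have oV : open V.
    apply: closed_openC; apply: compact_closed; first exact: flow_hausdorff.
    apply: continuous_compact; first exact/continuous_subspaceT/Gpi.1.
    exact: (compact_setT_closed (@flow_compact _ X) (open_closedC oO)).
  have Vz : V z by move=> [x nOx xz]; apply: nOx; exact: zO.
  have [g Vgy] := minimal_translate y mY oV (ex_intro _ z Vz).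
  exists g => _ [x xy <-]; apply: OB; apply: contrapT => nO; apply: Vgy.
  by exists (act g x) => //; rewrite Gpi.2 xy.
have /choice[g gP] : forall B : nbhs_directed x0, exists g : G,
    act g @` (pi @^-1` [set y]) `<=` sval B.
  by move=> [B nB]; exact: fibre.
have clF : closed (pi @^-1` [set y]).
  apply: (continuous_closedP pi).1; first exact: Gpi.1.
  exact: compact_closed (@flow_hausdorff _ Y) (@compact_set1 _ _).
have F0 : (pi @^-1` [set y]) !=set0 by have [x _ xy] := spi y Logic.I; exists x.
pose F := Hyperspace (compact_setT_closed (@flow_compact _ X) clF) F0.
exists (nbhs_directed x0), g, (fun i => hyp_action (actP X) (g i) F), x0.
split=> //.
apply: hyp_cvg => O oO /=.
  move=> xO; have nO : nbhs x0 O by apply: open_nbhs_nbhs; split=> //; exact: xO.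
  exists (exist _ O nO : nbhs_directed x0) => // B /= BO.
  exact: subset_trans (gP B) BO.
move=> [_ [-> Ox]]; have nO : nbhs x0 O by apply: open_nbhs_nbhs.
exists (exist _ O nO : nbhs_directed x0) => // B /= BO; case: (F0) => x xy.
by exists (act (g B) x); split; [exists x|apply/BO/gP; exists x].
Qed.

(** * The compactification flow *)

Section AutOrbits.
Variables (G : topologicalGroupType) (M : flow G).
Hypothesis uM : universal_minimal_flow M.
Variable tM : tame M.
Let mM : minimal M := uM.1.
Local Notation K := (aut_group mM tM).
Let cK : compact [set: K] := @aut_compact _ _ mM tM uM.
Let hK : hausdorff_space K := @aut_hausdorff _ _ mM tM.

Local Notation KM := (prod_flow (trivial_flow G cK hK) M).
Local Notation H := (hyp_flow KM).

(** The inverse makes right multiplication a left action. It commutes with [G], which acts trivially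
    on the first factor. *)
Definition translation (k : K) (p : KM) : KM := ((p.1 * k^-1)%g, p.2).

Lemma translation_continuous_action : is_continuous_action translation.
Proof.
split.
- by move=> [n x]; rewrite /translation invg1 mulg1.
- by move=> k l [n x]; rewrite /translation /= invgM mulgA.
- have cK1 : continuous (fun p : K * KM => p.1) by move=> ?; exact: cvg_fst.
  have cKM : continuous (fun p : K * KM => p.2) by move=> ?; exact: cvg_snd.
  have c1 : continuous (fun p : KM => p.1 : K) by move=> ?; exact: cvg_fst.
  have c2 : continuous (fun p : KM => p.2) by move=> ?; exact: cvg_snd.
  apply: (@continuous_pair (K * KM)%type K M _ _ _ (continuous_compose cKM c2)).
  exact: (continuous_compose (continuous_pair (continuous_compose cKM c1)
    (continuous_compose cK1 (@invg_continuous K))) (@mulg_continuous K)).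
Qed.

Lemma graph_compact (p : M) : compact (closure (range (fun n : K => (n, n p) : KM))).
Proof. exact: compact_setT_closed (@flow_compact _ KM) (@closed_closure _ _). Qed.

Lemma graph_nonempty (p : M) : closure (range (fun n : K => (n, n p) : KM)) !=set0.
Proof. by exists (1%g, p); apply: subset_closure; exists 1%g. Qed.

(** The closure is taken because the map from [n] to [n p] has not been shown continuous for the
    topology of [K]. *)
Definition orbit_graph (p : M) : H :=
  Hyperspace (@graph_compact p) (@graph_nonempty p).

Definition shift (k : K) : H -> H := hyp_action translation_continuous_action k.

Lemma shift_continuous_action : is_continuous_action shift.
Proof.
exact: (hyp_action_continuous_action translation_continuous_action
  (@flow_compact _ KM) (@flow_hausdorff _ KM)).
Qed.

Lemma shift_act k g (L : H) : shift k (act g L) = act g (shift k L).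
Proof. by apply: hyp_ext; rewrite /= !image_comp. Qed.

Lemma mem_orbit_graph (p : M) (n : K) : hset (orbit_graph p) (n, n p).
Proof. by apply: subset_closure; exists n. Qed.

Lemma orbit_graph_meet (p : M) (O : set KM) :
  open O -> hset (orbit_graph p) `&` O !=set0 -> exists n : K, O (n, n p).
Proof.
by move=> oO [z [/closureP cz Oz]]; have [_ [[n _ <-] On]] := cz O oO Oz; exists n.
Qed.

Lemma act_orbit_graph g (p : M) : act g (orbit_graph p) = orbit_graph (act g p).
Proof.
apply: hyp_ext; rewrite /= (image_closure_action (actP KM)) image_comp.
by congr closure; congr (_ @` _); apply/funext => n; rewrite /= /prod_act /= aut_act.
Qed.

Lemma shift_orbit_graph k (p : M) : shift k (orbit_graph p) = orbit_graph (k p).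
Proof.
apply: hyp_ext; rewrite /= (image_closure_action translation_continuous_action).
congr closure; apply/seteqP; split=> [_ [_ [n _ <-] <-]|_ [n _ <-]].
  exists (n * k^-1)%g => //; by congr pair; rewrite autM autK.
exists ((n * k)%g, (n * k)%g p); first by exists (n * k)%g.
by rewrite /translation /= mulgK.
Qed.

Let E : set H := closure (range orbit_graph).

Lemma shift_E k L : E L -> E (shift k L).
Proof.
move=> EL; have : (shift k @` E) (shift k L) by exists L.
rewrite (image_closure_action shift_continuous_action); apply: closureS.
by move=> _ [_ [p _ <-] <-]; rewrite shift_orbit_graph; exists (k p).
Qed.

Lemma E_invariant : invariant E.
Proof.
apply: closure_invariant => g _ [p _ <-]; rewrite act_orbit_graph.
by exists (act g p).
Qed.

Definition orbit_section (psi : M -> H) :=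
  [/\ continuous psi, forall p, E (psi p) & forall p, hset (psi p) (1%g, p)].

(** The set [psi p] is a limit of orbit graphs, and since it contains [(1, p)], a close enough graph
    of some [q] contains a pair [(n, n q)] near [(1, p)]. Shifting by [n], which is close to 1,
    gives the graph of [n q], still in [O], with [n q] in [B]. *)
Lemma orbit_section_approx psi p (B : set M) (O : set H) : orbit_section psi ->
  open B -> B p -> open O -> O (psi p) -> exists2 q, B q & O (orbit_graph q).
Proof.
move=> [cpsi Epsi psi1] oB Bp oO Op.
have Op1 : O (shift 1%g (psi p)) by rewrite (action1 shift_continuous_action).
have [N [O' [oN oO' N1 O'p NO]]] := action_nbhs shift_continuous_action oO Op1.
have oNB : open ((N : set K) `*` B) by exact: open_setX.
have [|_ [[q _ <-] [O'q /(orbit_graph_meet oNB)[n [Nn Bn]]]]] :=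
  (closureP _ _).1 (Epsi p) _ (openI oO' (open_hyp_meet oNB)).
  by split=> //; exists (1%g, p).
by exists (n q) => //; rewrite -shift_orbit_graph; exact: NO.
Qed.

(** Near [psi p] there are orbit graphs of points [q] close to [p]; they contain [(n, n q)], which
    is close to [(n, n p)], and membership is a closed relation. *)
Lemma orbit_section_graph psi p (n : K) : orbit_section psi ->
  hset (psi p) (n, n p).
Proof.
move=> spsi; apply: contrapT.
move=> /(hyp_notin_open (@flow_compact _ KM) (@flow_hausdorff _ KM)).
move=> [P [V [oP oV Pp Vn PV]]].
have [A [B [oA oB An Bn AB]]] := @open_prod_nbhs K M V n (n p) oV Vn.
have [q Bq Pq] := orbit_section_approx spsi
  (aut_open_preimage (aut_funP n) oB) Bn oP Pp.
by apply: (PV _ (n, n q) Pq); [exact: AB|exact: mem_orbit_graph].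
Qed.

(** A point of [psi p] is approached by points of orbit graphs of [q] close to [p]. Such graphs lie
    inside [psi' q], which is close to [psi' p], so the point belongs to [psi' p]; the roles are
    then exchanged. *)
Lemma orbit_section_unique psi1 psi2 : orbit_section psi1 -> orbit_section psi2 ->
  psi1 = psi2.
Proof.
have sub psi psi' p : orbit_section psi -> orbit_section psi' ->
    hset (psi p) `<=` hset (psi' p).
  move=> s s' z pz; apply: contrapT.
  move=> /(hyp_notin_open (@flow_compact _ KM) (@flow_hausdorff _ KM)).
  move=> [P [V [oP oV Pp Vz PV]]].
  have oP' : open (psi' @^-1` P) by apply: (continuousP psi').1 => //; case: s'.
  have [|q Pq /(orbit_graph_meet oV)[n Vn]] :=
    orbit_section_approx s oP' Pp (open_hyp_meet oV).
    by exists z.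
  by apply: (PV _ _ Pq Vn); exact: orbit_section_graph.
move=> s1 s2; apply/funext => p; apply: hyp_ext; apply/seteqP; split; exact: sub.
Qed.

(** Conjugating [psi] by [k] yields another section, so uniqueness applies. It is normalised because
    [psi] at [k^-1 q] contains [(k, q)], which the shift sends to [(1, q)]. *)
Lemma orbit_section_equivariant psi (k : K) p : orbit_section psi ->
  shift k (psi p) = psi (k p).
Proof.
move=> s; have [cpsi Epsi _] := s.
have {2}-> : psi = fun p => shift k (psi ((k^-1)%g p)).
  apply: orbit_section_unique => //; split.
  - apply: continuous_compose;
      last exact: (action_continuous shift_continuous_action).
    by apply: continuous_compose; [exact: aut_continuous|exact: cpsi].
  - by move=> q; exact/shift_E/Epsi.
  - move=> q; exists (k, q); last by rewrite /translation /= mulgV.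
    by have := orbit_section_graph ((k^-1)%g q) k s; rewrite autVK.
by rewrite autK.
Qed.

(** Suppose [psi q = psi p] with [p] in [C] and [q] outside [closure A0]. Then [psi p] contains
    [(1, q)], so approximation gives [p'] in [C] and [n] in the ball of [C] around 1 with [n p']
    outside [closure A0], against tameness. *)
Lemma orbit_section_irreducible psi (A : set M) : orbit_section psi ->
  open A -> A !=set0 -> exists p : M, psi @^-1` [set psi p] `<=` A.
Proof.
move=> s oA [x Ax].
have [A0 [oA0 A0x cA0]] := compact_hausdorff_regular (@flow_compact _ M)
  (@flow_hausdorff _ M) oA Ax.
have [C [oC C0 CA tC]] := @tame_aut _ _ mM tM A0 oA0 (ex_intro _ x A0x).
have [p Cp] := C0; exists p => q /= qp; apply/cA0; apply: contrapT => nA0q.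
have oW : open (aut_ball C (1%g : K) `*` ~` closure A0).
  by apply: open_setX; [exact: open_aut_ball|exact/closed_openC/closed_closure].
have [|p' Cp' /(orbit_graph_meet oW)[n [/= Cn nA0]]] :=
    orbit_section_approx s oC Cp (open_hyp_meet oW).
  exists (1%g, q); split; first by rewrite -qp; case: s.
  by split=> //=; exists p, p.
by apply/nA0/subset_closure/tC.
Qed.

Lemma exists_orbit_section : exists2 psi, orbit_section psi & G_map psi.
Proof.
have [||| S SE mS] := @exists_minimal_set G H E.
- exact: closed_closure.
- by case: mM.1 => p _; exists (orbit_graph p); apply: subset_closure; exists p.
- exact: E_invariant.
have [cS _ iS _] := mS.
have [phi [Gphi _]] := uM.2 _ (minimal_subflow cS iS mS).
pose psi0 p : H := \val (phi p).
have Gpsi0 : G_map psi0 := G_map_comp Gphi (subflow_val_G_map cS iS).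
have Epsi0 p : E (psi0 p) by apply: SE; exact: set_valP.
pose Q : set (prod_flow M M) := [set p | hset (psi0 p.1) (1%g, p.2)].
have cQ : closed Q.
  rewrite -openC openE => -[p q] /=.
  move=> /(hyp_notin_open (@flow_compact _ KM) (@flow_hausdorff _ KM)).
  move=> [P [V [oP oV Pp Vq PV]]].
  have [A [B [oA oB A1 Bq AB]]] := @open_prod_nbhs K M V 1%g q oV Vq.
  have oP' : open (psi0 @^-1` P) by apply: (continuousP psi0).1 => //; exact: Gpsi0.1.
  exists (psi0 @^-1` P, B).
    by split; apply: open_nbhs_nbhs.
  by move=> [p' q'] [/= Pp' Bq']; apply: PV Pp' _; exact: AB.
have Q0 : Q !=set0.
  have [p _] := mM.1; apply: contrapT => nQ.
  (* If [psi0 p] had no point over 1, all orbit graphs close to it would miss the closed slice over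
     1, whereas the graph of [q] contains [(1, q)]. *)
  have c1 : closed (([set 1%g] : set K) `*` [set: M]).
    apply: compact_closed; first exact: (@flow_hausdorff _ KM).
    by apply: compact_setX; [exact: compact_set1|exact: flow_compact].
  have [|_ [[q _ <-] /= Lq]] :=
    (closureP _ _).1 (Epsi0 p) _ (open_hyp_sub (closed_openC c1)).
    by move=> [n q] npq [/= n1 _]; apply: nQ; exists (p, q); rewrite /Q /= -n1.
  by apply: (Lq (1%g, q)) => //; exact: mem_orbit_graph.
have iQ : invariant Q.
  move=> g [p q] /= Qpq; rewrite /Q /= Gpsi0.2.
  by exists (1%g, q).
(* Thus [(1, f p)] lies in [psi0 p] for every [p], and precomposing [psi0] with the inverse of [f]
   normalises it. *)
have [f af Qf] := contains_graph uM cQ Q0 iQ.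
have [h [ah fK hK']] := aut_inv af.
exists (psi0 \o h); last exact: G_map_comp ah.1 Gpsi0.
split.
- by apply: continuous_compose; [exact: ah.1.1|exact: Gpsi0.1].
- by move=> p; exact: Epsi0.
- by move=> p; have := Qf (h p); rewrite hK'.
Qed.

End AutOrbits.

(** * Passage to the universal compactification flow *)

Lemma closed_invariant_preimage (G : topologicalGroupType) (X Y : flow G)
    (f : X -> Y) (S : set Y) : G_map f -> closed S -> invariant S ->
  closed (f @^-1` S) /\ invariant (f @^-1` S).
Proof.
move=> [cf ef] cS iS; split; first exact: (continuous_closedP f).1.
by move=> g x Sfx; rewrite /preimage /= ef; exact: iS.
Qed.

Lemma pair_G_map (G : topologicalGroupType) (X X' Y Y' : flow G)
    (f : X -> Y) (f' : X' -> Y') : G_map f -> G_map f' ->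
  G_map (fun p : prod_flow X X' => (f p.1, f' p.2) : prod_flow Y Y').
Proof.
move=> [cf ef] [cf' ef']; split; last first.
  by move=> g [x x'] /=; rewrite /prod_act /= ef ef'.
by apply: continuous_pair; apply: continuous_compose => //;
  [move=> ?; exact: cvg_fst|move=> ?; exact: cvg_snd].
Qed.

(** The flow [Z] is the range of an equivariant section, stable under shifts because the section
    commutes with [K]; the proximal factor is its orbit space under [K]. *)
Lemma exists_irreducible_compactification (G : topologicalGroupType) (M : flow G) :
  universal_minimal_flow M -> tame M ->
  exists (Z : flow G) (psi : M -> Z),
    [/\ compactification_flow Z, minimal Z & irreducible psi].
Proof.
move=> uM tM; have mM := uM.1.
have [psi spsi Gpsi] := exists_orbit_section uM tM.
pose Z := range_flow Gpsi; pose psi' : M -> Z := to_range Gpsi.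
have Gpsi' : G_map psi' := to_range_G_map Gpsi.
have spsi' : forall z, exists p, psi' p = z := fun z => to_range_surj z.
have mZ : minimal Z := minimal_image mM Gpsi' spsi'.
pose K : topologicalGroupType := aut_group uM.1 tM.
have rK (k : aut_group uM.1 tM) z : range psi z -> range psi (shift k z).
  by move=> [p _ <-]; exists (k p) => //; rewrite orbit_section_equivariant.
pose k : K -> Z -> Z := sub_action rK.
have ck : is_continuous_action k :=
  sub_action_continuous_action (shift_continuous_action uM tM) rK.
have kpsi (c : K) p : k c (psi' p) = psi' (c p).
  by apply: val_inj; exact: orbit_section_equivariant.
have kG (c : K) g (z : Z) : k c (act g z) = act g (k c z).
  by apply: val_inj; exact: shift_act.
have cK : compact [set: K] by exact: aut_compact.
pose Y := orbit_flow ck cK kG; pose phi : Z -> Y := orbit_map ck cK kG.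
have Gphi : G_map phi by exact: to_range_G_map.
have sphi : forall y, exists z, phi z = y by exact: to_range_surj.
have mY : minimal Y := minimal_image mZ Gphi sphi.
have Gchi := G_map_comp Gpsi' Gphi.
exists Z, psi'; split=> //.
- exists Y, phi; split.
    split=> // y0 y1.
    have [z0 <-] := sphi y0; have [z1 <-] := sphi y1.
    have [p0 <-] := spsi' z0; have [p1 <-] := spsi' z1.
    (* Pulled back to [M * M], the orbit closure of this pair contains the graph of an automorphism
       [f]. As [x] and [f x] have the same image in the orbit space, the orbit closure meets the
       diagonal, which gives proximality. *)
    pose y : prod_flow Y Y := (phi (psi' p0), phi (psi' p1)).
    pose O := range (fun g : G => act g y).
    have [cQ iQ] := closed_invariant_preimage (pair_G_map Gchi Gchi)
      (@closed_closure _ O) (closure_invariant (@orbit_invariant _ _ y)).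
    have [| f af Qf] := contains_graph uM cQ _ iQ.
      exists (p0, p1); apply: subset_closure; exists 1%g => //.
      exact: action1 (actP _) _.
    pose x := p0; have phix : phi (psi' (f x)) = phi (psi' x).
      apply/esym/orbit_map_eq; exists (AutGroup uM.1 tM af).
      exact: kpsi.
    have cx := Qf x; rewrite /preimage /= phix in cx.
    have [D [g [g0 g1]]] :=
      @closure_prod_cvg G Y (phi (psi' p0)) (phi (psi' p1)) _ cx.
    by exists D, g, (phi (psi' x)).
  split=> //; exists K, k; split=> //.
  + by split=> //; exact: aut_hausdorff.
  + move=> c; have Gk d : G_map (k d).
      by split; [exact: action_continuous ck _|exact: kG].
    split=> //; exists (k c^-1%g); split=> //; [exact: actionK|exact: actionVK].
  + by move=> z z'; exact: orbit_map_eq.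
- split=> //; first by move=> z _; have [p] := spsi' z; exists p.
  move=> B oB B0; have [p pB] := orbit_section_irreducible spsi oB B0.
  exists (psi' p) => q /= /(congr1 val) qp; exact: pB.
Qed.

Theorem theorem10p15 (G : topologicalGroupType) (hG : hausdorff_space G)
    (tmdG : TMD G)
    (M : flow G) (hM : universal_minimal_flow M)
    (Z : flow G) (hZ : universal_compactification_flow Z)
    (iota : M -> Z) (hiota : G_map iota) :
  highly_proximal iota /\ irreducible iota.
Proof.
have mM := hM.1.
have mZ : minimal Z by case: hZ => -[Y [phi [_ []]]].
have [Z' [psi [cfZ' mZ' [Gpsi spsi irr]]]] :=
  exists_irreducible_compactification hM (TMD_tame tmdG hM).
have [f [Gf _]] := hZ.2 Z' cfZ'.
have siota := G_map_surj mM.1 mZ hiota.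
suff irri : irreducible iota by split=> //; exact: irreducible_highly_proximal.
split=> //; first by move=> z _; have [p] := siota z; exists p.
move=> B oB B0.
pose Diag := [set p : prod_flow Z' Z' | p.1 = p.2].
have cDiag : closed Diag.
  rewrite -openC openE => -[y z] /= /(hausdorff_sep (@flow_hausdorff _ Z')).
  move=> [U [V [oU oV Uy Vz UV]]].
  exists (U, V); first by split; exact: open_nbhs_nbhs.
  by move=> [y' z'] [/= Uy' Vz'] e; apply: (UV y' Uy'); rewrite [y'](e : y' = z').
have iDiag : invariant Diag by move=> g p e; exact: (congr1 (act g) e).
(* The pairs [(x, x')] with [f (iota x) = psi x'] form a closed invariant set, so it contains the
   graph of an automorphism [a], and [f \o iota = psi \o a]. *)
have [cQ iQ] := closed_invariant_preimage
  (pair_G_map (G_map_comp hiota Gf) Gpsi) cDiag iDiag.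
have [|a aa Qa] := contains_graph hM cQ _ iQ.
  have [[p _] _] := mM; have [q _ pq] := spsi (f (iota p)) Logic.I.
  by exists (p, q); rewrite /preimage /Diag /= pq.
have aB0 : (a @` B) !=set0 by case: B0 => x Bx; exists (a x), x.
(* The image of [B] under [a] contains the fibre of [psi] over [z = psi p]. Every point with the
   same image under [iota] as [h p], for [h] the inverse of [a], is sent by [a] into that fibre,
   hence lies in [B]. *)
have [z zB] := irr _ (aut_open_image aa oB) aB0.
have [p _ pz] := spsi z Logic.I.
have [h [ah aK hK]] := aut_inv aa.
exists (iota (h p)) => x /= xp.
have : (a @` B) (a x).
  apply: zB; rewrite /= -pz.
  have := Qa x; rewrite /preimage /Diag /= xp => <-.
  by have := Qa (h p); rewrite /preimage /Diag /= hK.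
by move=> [y By /(can_inj aK) <-].
Qed.
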